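(* The metric space $(\mathcal X^{+},\Box)$ of isomorphism classes of qm-spaces with the box distance is complete and separable.
   Context: A qm-space is a triple $(X,d_X,\mu_X)$ (written $X$) such that: $d_X\colon X\times X\to[0,+\infty)$ satisfies $d_X(x,x)=0$ and the triangle inequality; the symmetrization $d_X^{\mathrm s}(x,y)=\max\{d_X(x,y),d_X(y,x)\}$ is a complete separable metric on $X$; and $\mu_X$ is a Borel probability measure on $(X,d_X^{\mathrm s})$ with full support. Two qm-spaces $X,Y$ are isomorphic if there is a bijection $\varphi\colon X\to Y$ with $d_Y(\varphi(x),\varphi(x'))=d_X(x,x')$ for all $x,x'$ and $\varphi_*\mu_X=\mu_Y$. $\mathcal X^{+}$ is the set of isomorphism classes of qm-spaces. For a qm-space $X$, $\operatorname{Lip}^{+}_1(X)=\{f\colon X\to\mathbb R\mid f(y)-f(x)\leq d_X(x,y)\ \text{for all }x,y\in X\}$. $\mathcal T(\mu,\nu)$ is the set of couplings of the Borel probability measures $\mu,\nu$; $\operatorname{pr}_1,\operatorname{pr}_2$ are the projections of a product; $F\circ\operatorname{pr}_i=\{f\circ\operatorname{pr}_i\mid f\in F\}$; $(d)_H$ is the Hausdorff (pseudo)distance induced by a (pseudo)distance $d$. For closed $S\subset X\times Y$ (product of the symmetrized topologies), $d^S_\infty(h,k)=\sup_{(x,y)\in S}|h(x,y)-k(x,y)|$, and $(d^S_\infty)_H$ is set to $0$ if $S=\emptyset$. The box distance is $$\Box(X,Y)=\inf\max\{1-\pi(S),\,2(d^S_\infty)_H(\operatorname{Lip}^{+}_1(X)\circ\operatorname{pr}_1,\operatorname{Lip}^{+}_1(Y)\circ\operatorname{pr}_2)\},$$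 the infimum being over $\pi\in\mathcal T(\mu_X,\mu_Y)$ and closed $S\subset X\times Y$. It is a metric on $\mathcal X^{+}$. *)

(* Defs.v *)
From HB Require Import structures.
From mathcomp Require Import all_boot all_order all_algebra.
From mathcomp Require Import all_classical all_reals all_analysis.

Set Implicit Arguments.
Unset Strict Implicit.
Unset Printing Implicit Defensive.

Import Order.TTheory GRing.Theory Num.Theory.

Local Open Scope classical_set_scope.
Local Open Scope ring_scope.
Local Open Scope quotient_scope.

#[short(type="completeMetricType")]
HB.structure Definition CompleteMetric (R : numDomainType) :=
  {T of Metric R T & Complete T}.

Notation borel T := (g_sigma_algebraType (@open T)).

(* The carrier is equipped with the symmetrized metric (qdist_sym), which
   determines its topology and uniformity. The base point of the carrier is
   required by the hierarchy of measurable types; it is harmless because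
   a space carrying a probability measure is nonempty and isomorphisms need
   not preserve the base point. *)
Record qmSpace (R : realType) := QMSpace {
  qm_carrier :> completeMetricType R ;
  qdist : qm_carrier -> qm_carrier -> R ;
  qdist_ge0 : forall x y, 0 <= qdist x y ;
  qdistxx : forall x, qdist x x = 0 ;
  qdist_triangle : forall x y z, qdist x z <= qdist x y + qdist y z ;
  qdist_sym : forall x y, mdist x y = Num.max (qdist x y) (qdist y x) ;
  qm_separable : exists2 D : set qm_carrier, countable D & dense D ;
  qm_measure : probability (borel qm_carrier) R ;
  qm_full_support : forall U : set qm_carrier,
    open U -> U !=set0 -> (0 < qm_measure U)%E }.

Section isomorphism.
Variable R : realType.
Implicit Types X Y Z : qmSpace R.

(* Equality of measures is only required on Borel sets: the value of a measure
   on a non-measurable set carries no information. *)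
Definition is_qm_iso X Y (phi : X -> Y) : Prop :=
  [/\ bijective phi,
      forall x x', qdist (phi x) (phi x') = qdist x x' &
      forall A : set (borel Y), measurable A ->
        qm_measure X (phi @^-1` A) = qm_measure Y A].

Definition qm_iso X Y : Prop := exists phi : X -> Y, is_qm_iso phi.

Lemma preimage_g_sigma (S T : pointedType) (G : set (set S)) (H : set (set T))
    (f : S -> T) : (forall B, H B -> G (f @^-1` B)) ->
  measurable_fun setT (f : g_sigma_algebraType G -> g_sigma_algebraType H).
Proof.
move=> fHG; apply: (@measurability _ _ (g_sigma_algebraType G)
  (g_sigma_algebraType H) setT f H) => // _ [B HB <-].
by rewrite setTI; apply: sub_sigma_algebra; exact: fHG.
Qed.

Lemma isometry_continuous X Y (phi : X -> Y) :
  (forall x x', qdist (phi x) (phi x') = qdist x x') -> continuous phi.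
Proof.
move=> iphi x; apply/metricType_numDomainType.cvgrPdist_lt => e e0.
have : \forall t \near x, mdist x t < e.
  by apply/metricType_numDomainType.nbhs_mdistP; exists e.
by apply: filterS => t; rewrite !qdist_sym !iphi.
Qed.

Lemma iso_measurable X Y (phi : X -> Y) : is_qm_iso phi ->
  measurable_fun setT (phi : borel X -> borel Y).
Proof.
case=> _ /isometry_continuous/continuousP cphi _.
exact: preimage_g_sigma.
Qed.

Lemma is_qm_iso_inv X Y (phi : X -> Y) (psi : Y -> X) : is_qm_iso phi ->
  cancel phi psi -> cancel psi phi -> is_qm_iso psi.
Proof.
move=> [_ iphi mphi] phiK psiK.
have ipsi y y' : qdist (psi y) (psi y') = qdist y y' by rewrite -iphi !psiK.
split; [by exists phi|exact: ipsi|move=> A mA].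
rewrite -mphi.
  by congr (qm_measure X _); apply/seteqP; split=> x /=; rewrite phiK.
rewrite -[_ @^-1` _]setTI.
have /continuousP cpsi := isometry_continuous ipsi.
by apply: (preimage_g_sigma cpsi).
Qed.

Lemma qm_iso_refl X : qm_iso X X.
Proof. by exists id; split=> //; exists id. Qed.

Lemma qm_iso_sym X Y : qm_iso X Y -> qm_iso Y X.
Proof.
move=> [phi iphi]; have [[psi phiK psiK] _ _] := iphi.
by exists psi; exact: is_qm_iso_inv iphi phiK psiK.
Qed.

Lemma qm_iso_trans Y X Z : qm_iso X Y -> qm_iso Y Z -> qm_iso X Z.
Proof.
move=> [phi [bphi iphi mphi]] [psi ispsi].
have [bpsi ipsi mpsi] := ispsi.
exists (psi \o phi); split; first exact: bij_comp.
  by move=> x x' /=; rewrite ipsi iphi.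
move=> A mA; rewrite -mpsi// comp_preimage -mphi//.
by rewrite -[_ @^-1` _]setTI; exact: iso_measurable.
Qed.

HB.instance Definition _ := gen_eqMixin (qmSpace R).
HB.instance Definition _ := gen_choiceMixin (qmSpace R).

Definition qm_isob : rel (qmSpace R) := fun X Y => `[< qm_iso X Y >].

Lemma qm_isob_refl : reflexive qm_isob.
Proof. by move=> X; apply/asboolP; exact: qm_iso_refl. Qed.

Lemma qm_isob_sym : symmetric qm_isob.
Proof. by move=> X Y; apply/asboolP/asboolP; exact: qm_iso_sym. Qed.

Lemma qm_isob_trans : transitive qm_isob.
Proof.
by move=> Y X Z /asboolP XY /asboolP YZ; apply/asboolP; exact: qm_iso_trans YZ.
Qed.

Canonical qm_iso_equiv :=
  EquivRel qm_isob qm_isob_refl qm_isob_sym qm_isob_trans.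

Definition Xplus := {eq_quot qm_iso_equiv}.

End isomorphism.

Section box_distance.
Variable R : realType.
Implicit Types X Y : qmSpace R.
Local Open Scope ereal_scope.

Definition hausdorff_dist (T : Type) (d : T -> T -> \bar R) (A B : set T) :=
  maxe (ereal_sup [set ereal_inf [set d a b | b in B] | a in A])
       (ereal_sup [set ereal_inf [set d a b | a in A] | b in B]).

Definition Lip1 X : set (X -> R) :=
  [set f | forall x y, (f y - f x <= qdist x y)%R].
Arguments Lip1 X : clear implicits.

Definition coupling X Y (pi : probability (borel (X * Y)%type) R) : Prop :=
  (forall A : set (borel X), measurable A ->
     pi (fst @^-1` A) = qm_measure X A) /\
  (forall B : set (borel Y), measurable B ->
     pi (snd @^-1` B) = qm_measure Y B).

Definition dist_sup (T : Type) (S : set T) (h k : T -> R) : \bar R :=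
  ereal_sup [set `|h p - k p|%:E | p in S].

(* The value on set0 is a convention (a supremum over set0 is -oo here). *)
Definition lip_hausdorff X Y (S : set (X * Y)%type) : \bar R :=
  if `[< S = set0 >] then 0 else
  hausdorff_dist (dist_sup S) [set f \o fst | f in Lip1 X]
                              [set g \o snd | g in Lip1 Y].

Definition box X Y : \bar R := ereal_inf [set r |
  exists (pi : probability (borel (X * Y)%type) R) (S : set (X * Y)%type),
  [/\ coupling pi, closed S & r = maxe (1 - pi S) (2%:E * lip_hausdorff S)]].

Lemma hausdorff_dist_image (T U : Type) (F : T -> U) (d : T -> T -> \bar R)
    (e : U -> U -> \bar R) (A B : set T) :
  (forall a b, d a b = e (F a) (F b)) ->
  hausdorff_dist d A B = hausdorff_dist e (F @` A) (F @` B).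
Proof.
move=> dE; rewrite /hausdorff_dist; congr (maxe (ereal_sup _) (ereal_sup _)).
  rewrite [RHS]image_comp; apply: eq_imagel => a _ /=; congr ereal_inf.
  by rewrite [RHS]image_comp; apply: eq_imagel => b _ /=.
rewrite [RHS]image_comp; apply: eq_imagel => a _ /=; congr ereal_inf.
by rewrite [RHS]image_comp; apply: eq_imagel => b _ /=.
Qed.

Lemma Lip1_iso X X' (W W' : Type) (phi : X -> X') (F : W -> W')
    (p : W -> X) (p' : W' -> X') : is_qm_iso phi ->
  (forall w, phi (p w) = p' (F w)) ->
  [set h \o F | h in [set f \o p' | f in Lip1 X']] = [set f \o p | f in Lip1 X].
Proof.
move=> [[psi phiK psiK] iphi _] pF; rewrite image_comp.
apply/seteqP; split=> _ [f Lf <-].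
  exists (f \o phi); first by move=> x y /=; rewrite -iphi; exact: Lf.
  by apply/funext => w /=; rewrite pF.
exists (f \o psi).
  move=> x y /=; rewrite -[x in qdist x]psiK -[y in qdist _ y]psiK iphi.
  exact: Lf.
by apply/funext => w /=; rewrite -pF phiK.
Qed.

Lemma le_box_iso X X' Y Y' :
  qm_iso X X' -> qm_iso Y Y' -> box X' Y' <= box X Y.
Proof.
move=> [phi iphi] [psi ipsi]; apply: le_ereal_inf_tmp => r /=.
move=> [pi [S [[pi1 pi2] cS ->]]].
have [[phi' phiK phi'K] dphi mphi] := iphi.
have [[psi' psiK psi'K] dpsi mpsi] := ipsi.
have iphi' := is_qm_iso_inv iphi phiK phi'K.
have ipsi' := is_qm_iso_inv ipsi psiK psi'K.
pose F (p : X * Y) : X' * Y' := (phi p.1, psi p.2).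
pose G (p : X' * Y') : X * Y := (phi' p.1, psi' p.2).
have prod_cont (U V U' V' : qmSpace R) (f : U -> U') (g : V -> V') :
    is_qm_iso f -> is_qm_iso g -> continuous (fun p => (f p.1, g p.2)).
  move=> [_ /isometry_continuous cf _] [_ /isometry_continuous cg _] [x y].
  apply: cvg_pair => /=.
    by apply: (@cvg_comp _ _ _ fst f _ (nbhs x)); [exact: cvg_fst|exact: cf].
  by apply: (@cvg_comp _ _ _ snd g _ (nbhs y)); [exact: cvg_snd|exact: cg].
have cF : continuous F by exact: prod_cont.
have cG : continuous G by exact: prod_cont.
have FK : cancel F G by move=> [x y]; rewrite /F /G /= phiK psiK.
have GK : cancel G F by move=> [x y]; rewrite /F /G /= phi'K psi'K.
have mF : measurable_fun setT
    (F : borel (X * Y)%type -> borel (X' * Y')%type).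
  by apply: preimage_g_sigma; exact/continuousP.
pose HF := isMeasurableFun.Build _ _ (borel (X * Y)%type)
  (borel (X' * Y')%type) F mF.
pose Fm : {mfun borel (X * Y)%type >-> borel (X' * Y')%type} := HB.pack F HF.
pose pi' : probability (borel (X' * Y')%type) R := distribution pi Fm.
have pi'E A : pi' A = pi (F @^-1` A) by [].
have SE : F @^-1` (G @^-1` S) = S by apply/seteqP; split=> p /=; rewrite FK.
apply: ereal_inf_lbound; exists pi', (G @^-1` S); split.
- split=> A mA; rewrite pi'E.
    rewrite -mphi// -pi1//.
    by rewrite -[_ @^-1` _]setTI; exact: iso_measurable.
  rewrite -mpsi// -pi2//.
  by rewrite -[_ @^-1` _]setTI; exact: iso_measurable.
- by move/continuous_closedP : cG; exact.
- rewrite pi'E SE; congr (maxe _ (_ * _)); rewrite /lip_hausdorff.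
  have -> : `[< G @^-1` S = set0 >] = `[< S = set0 >].
    apply/asboolP/asboolP => [GS|->]; last by rewrite preimage_set0.
    by rewrite -SE GS preimage_set0.
  case: ifPn => // _.
  rewrite -(@Lip1_iso _ _ _ _ phi F fst fst)//.
  rewrite -(@Lip1_iso _ _ _ _ psi F snd snd)//.
  rewrite -(@hausdorff_dist_image _ _ _ (dist_sup (G @^-1` S)))// => h k.
  congr ereal_sup; apply/seteqP; split=> _ [p Sp <-].
    by exists (G p) => //=; rewrite GK.
  by exists (F p) => //=; rewrite FK.
Qed.

Lemma box_iso X X' Y Y' : qm_iso X X' -> qm_iso Y Y' -> box X Y = box X' Y'.
Proof.
move=> XX' YY'; apply/eqP; rewrite eq_le; apply/andP; split.
  by apply: le_box_iso; exact: qm_iso_sym.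
exact: le_box_iso.
Qed.

Definition box_dist (C D : Xplus R) : \bar R := box (repr C) (repr D).

Lemma box_distE X Y : box_dist (\pi_(Xplus R) X) (\pi_(Xplus R) Y) = box X Y.
Proof.
have h Z : qm_iso (repr (\pi_(Xplus R) Z)) Z.
  by apply/asboolP; have /eqmodP := reprK (\pi_(Xplus R) Z).
by apply: box_iso; exact: h.
Qed.

End box_distance.

Section metric_properties.
Variables (R : realType) (T : Type) (d : T -> T -> \bar R).
Local Open Scope ereal_scope.

Definition cauchy_sequence (u : nat -> T) : Prop :=
  forall e : R, (0 < e)%R ->
    exists N, forall m n, (N <= m)%N -> (N <= n)%N -> d (u m) (u n) < e%:E.

Definition converges_to (u : nat -> T) (x : T) : Prop :=
  forall e : R, (0 < e)%R ->
    exists N, forall n, (N <= n)%N -> d (u n) x < e%:E.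

Definition complete_dist : Prop :=
  forall u, cauchy_sequence u -> exists x, converges_to u x.

Definition separable_dist : Prop :=
  exists2 D : set T, countable D &
    forall x (e : R), (0 < e)%R -> exists2 y, D y & d x y < e%:E.

End metric_properties.

(* Main.v *)
Require Import Defs.
From HB Require Import structures.
From mathcomp Require Import all_boot all_order all_algebra.
From mathcomp Require Import all_classical all_reals all_analysis.
From mathcomp Require Import lra measurable_realfun.

(** The box distance only sees couplings and distortion. On a nonempty set S,
twice the Hausdorff distance between the two families of 1-Lipschitz functions
is the largest discrepancy of the two quasi-distances over S: a McShane
extension bounds the former by the latter, and the functions [qdist x] give
the converse. Hence [box X Y <= e] as soon as some probability space maps to X
and to Y, preserving the measures, in such a way that the two pulled back
quasi-distances differ by at most e outside a set of measure e ([box_le]), and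
[box X Y < e] provides such a coupling ([box_lt_coupling]).

Finitely many labels suffice to combine couplings, so that no disintegration
of measures is needed. Up to a set of small measure, a qm-space is cut into
finitely many labelled pieces of small diameter ([labelling]), and two labelled
probability spaces are coupled, with any prescribed joint law of the labels
whose marginals are right, by a finite combination of restrictions of the
product measure ([gluing]).

Completeness. A Cauchy sequence has a subsequence Y with
[box (Y k) (Y k.+1) < 2^-k]. Label each Y k at scale 2^-k. The couplings of
consecutive terms prescribe the joint laws of consecutive labels, and a Markov
chain of labels with these joint laws lives on the unit interval, because
subsets of the interval can be cut into pieces of any prescribed Lebesgue
measures ([label_chain]). By the Borel-Cantelli argument of [eventually_good],
the quasi-distance between the k-th labels of two points of the interval then
changes by at most a multiple of 2^-k for all large k, so it converges to a
quasi-pseudometric D on the interval. An asymmetric Kuratowski embedding turns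
D into a qm-space: the point u is sent to the sequence of the numbers D (c n) u,
where c is a dense sequence, and the space consists of the uniform limits of
such sequences that lie in the support of the image measure ([realizationP]).
Every term of the Cauchy sequence that is close to Y k is compared with this
limit by coupling the two along the labels of Y k ([chain_limit]); this yields
the convergence of the whole sequence without the triangle inequality.

Separability. The number of labels, and the masses of the labels and the
distances between the labelled points rounded down to a fine grid, form a code
with countably many values. If two spaces have the same code, then their
labels can be coupled so as to agree with high probability, and the spaces are
close ([box_code]); choosing one space for each code at each scale gives a
countable dense set ([separable_of_codes]). *)

Set Implicit Arguments.
Unset Strict Implicit.
Unset Printing Implicit Defensive.
Import Order.TTheory GRing.Theory Num.Theory.
Import numFieldNormedType.Exports.
Local Open Scope classical_set_scope.
Local Open Scope ring_scope.

(** * Distortion and the Hausdorff distance of Lipschitz functions *)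

Section distortion.
Variable R : realType.
Implicit Types X Y Z : qmSpace R.

(** McShane extension: g is the largest function that is 1-Lipschitz on Y and
at most f + e / 2 along S. The bound on the distortion costs e, and centring
the error splits it into two halves. *)
Lemma Lip1_extension X Y (S : set (X * Y)) (e : R) (f : X -> R) : S !=set0 ->
  (forall p p', S p -> S p' -> qdist p.1 p'.1 <= qdist p.2 p'.2 + e) ->
  Lip1 f ->
  exists2 g : Y -> R, Lip1 g & forall p, S p -> `|f p.1 - g p.2| <= e / 2.
Proof.
move=> [p0 Sp0] dS Lf.
pose V y := [set f p.1 + qdist p.2 y + e / 2 | p in S].
have V0 y : V y !=set0 by exists (f p0.1 + qdist p0.2 y + e / 2), p0.
have Vlb y : has_lbound (V y).
  exists (f p0.1 - e - qdist y p0.2 + e / 2) => _ [p Sp <-].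
  have := Lf p.1 p0.1; have := dS p p0 Sp Sp0.
  have := qdist_triangle p.2 y p0.2.
  lra.
exists (fun y => inf (V y)).
  move=> y y' /=; rewrite lerBlDr -lerBlDl.
  apply: lb_le_inf => // _ [p Sp <-].
  have : inf (V y') <= f p.1 + qdist p.2 y' + e / 2.
    by apply: ge_inf => //; exists p.
  have := qdist_triangle p.2 y y'; lra.
move=> p Sp; rewrite ler_distl.
have le1 : inf (V p.2) <= f p.1 + e / 2.
  by apply: ge_inf => //; exists p => //; rewrite qdistxx addr0.
have le2 : f p.1 - e / 2 <= inf (V p.2).
  apply: lb_le_inf => // _ [p' Sp' <-].
  have := Lf p'.1 p.1; have := dS p' p Sp' Sp; lra.
lra.
Qed.

Definition distortion_le X Y (S : set (X * Y)) (e : R) :=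
  forall p p', S p -> S p' -> `|qdist p.1 p'.1 - qdist p.2 p'.2| <= e.

Lemma qdist_lipschitz X (x x' y y' : X) :
  `|qdist x y - qdist x' y'| <= mdist x x' + mdist y y'.
Proof.
have h (u v : X) : qdist u v <= mdist u v /\ qdist v u <= mdist u v.
  by rewrite qdist_sym !le_max !lexx orbT.
have [a1 a2] := h x x'; have [b1 b2] := h y y'.
have c1 := qdist_triangle x x' y; have c2 := qdist_triangle x' y' y.
have d1 := qdist_triangle x' x y'; have d2 := qdist_triangle x y y'.
rewrite ler_norml; lra.
Qed.

(** This is what allows arbitrary sets in place of closed ones. *)
Lemma distortion_closure X Y (S : set (X * Y)) (e : R) :
  distortion_le S e -> distortion_le (closure S) e.
Proof.
move=> dS p p' Sp Sp'; apply/ler_addgt0Pr => r r0.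
have r4 : 0 < r / 4 by rewrite divr_gt0.
have near (q : X * Y) : closure S q -> exists2 s, S s &
    mdist q.1 s.1 < r / 4 /\ mdist q.2 s.2 < r / 4.
  case/(_ (ball q (r / 4)) (nbhsx_ballx _ _ r4)) => s [Ss [/= b1 b2]].
  by exists s => //; move: b1 b2; rewrite !ballEmdist.
have [s Ss [s1 s2]] := near _ Sp; have [s' Ss' [s1' s2']] := near _ Sp'.
have := dS _ _ Ss Ss'.
have := qdist_lipschitz p.1 s.1 p'.1 s'.1.
have := qdist_lipschitz p.2 s.2 p'.2 s'.2.
rewrite !ler_norml; lra.
Qed.

Local Open Scope ereal_scope.

Lemma lip_hausdorff_le X Y (S : set (X * Y)) (e : R) : (0 <= e)%R ->
  distortion_le S e -> 2%:E * lip_hausdorff S <= e%:E.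
Proof.
move=> e0 dS; rewrite /lip_hausdorff; case: ifPn => [_|/asboolP/eqP/set0P S0].
  by rewrite mule0 lee_fin.
have -> : e%:E = 2%:E * (e / 2)%:E by rewrite -EFinM mulrC divfK.
rewrite lee_pmul2l// /hausdorff_dist ge_max; apply/andP; split.
  apply: ub_ereal_sup => _ [_ [f Lf <-] <-].
  have [p p' Sp Sp'|g Lg fg] := @Lip1_extension X Y S e f S0 _ Lf.
    by move: (dS p p' Sp Sp'); rewrite ler_distl; lra.
  apply: (@le_trans _ _ (dist_sup S (f \o fst) (g \o snd))).
    by apply: ereal_inf_lbound; exists (g \o snd) => //; exists g.
  by apply: ub_ereal_sup => _ [p Sp <-]; rewrite lee_fin; exact: fg.
apply: ub_ereal_sup => _ [_ [g Lg <-] <-].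
pose S' := [set p : Y * X | S (p.2, p.1)].
have [|p p' Sp Sp'|f Lf fg] := @Lip1_extension Y X S' e g _ _ Lg.
- by case: S0 => p Sp; exists (p.2, p.1); rewrite /S'/= -surjective_pairing.
- by move: (dS _ _ Sp Sp'); rewrite ler_distl/=; lra.
apply: (@le_trans _ _ (dist_sup S (f \o fst) (g \o snd))).
  by apply: ereal_inf_lbound; exists (f \o fst) => //; exists f.
apply: ub_ereal_sup => _ [p Sp <-]; rewrite lee_fin distrC.
by apply: (fg (p.2, p.1)); rewrite /S'/= -surjective_pairing.
Qed.

(** The quasi-distance to a point is recovered from 1-Lipschitz functions: the
function [qdist x] is one of them, and a 1-Lipschitz function close to it on
the other side bounds a difference of quasi-distances. *)
Lemma lip_hausdorff_distortion X Y (S : set (X * Y)) (e : R) :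
  2%:E * lip_hausdorff S < e%:E -> distortion_le S e.
Proof.
have [->|/eqP/set0P S0] := pselect (S = set0); first by move=> _ p p' [].
rewrite /lip_hausdorff asboolF; last exact/eqP/set0P.
have -> : e%:E = 2%:E * (e / 2)%:E by rewrite -EFinM mulrC divfK.
rewrite lte_pmul2l// /hausdorff_dist gt_max => /andP[h1 h2].
move=> p p' Sp Sp'; rewrite ler_distl.
have L (W : qmSpace R) (w : W) : Lip1 (qdist w).
  by move=> x y /=; rewrite lerBlDl; exact: qdist_triangle.
apply/andP; split.
  have : ereal_inf [set dist_sup S a b | a in [set f \o fst | f in @Lip1 R X] &
      b in [set qdist p.2 \o snd]] < (e / 2)%:E.
    apply: le_lt_trans h2; apply: ereal_sup_ubound => /=.
    exists (qdist p.2 \o snd); first by exists (qdist p.2) => //; exact: L.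
    congr ereal_inf; apply/seteqP; split.
      by move=> _ [a ? <-]; exists a => //; exists (qdist p.2 \o snd).
    by move=> _ [a ? [_ -> <-]]; exists a.
  move=> /ereal_inf_lt[_ [_ [f Lf <-] [_ -> <-]]] fg.
  have lt q : S q -> (`|f q.1 - qdist p.2 q.2| < e / 2)%R.
    move=> Sq; rewrite -lte_fin; apply: le_lt_trans fg.
    by apply: ereal_sup_ubound; exists q.
  have := lt _ Sp; have := lt _ Sp'; rewrite qdistxx !ltr_distl.
  have := Lf p.1 p'.1; lra.
have : ereal_inf [set dist_sup S (qdist p.1 \o fst) b |
    b in [set g \o snd | g in @Lip1 R Y]] < (e / 2)%:E.
  apply: le_lt_trans h1; apply: ereal_sup_ubound => /=.
  by exists (qdist p.1 \o fst) => //; exists (qdist p.1) => //; exact: L.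
move=> /ereal_inf_lt[_ [_ [f Lf <-] <-]] fg.
have lt q : S q -> (`|qdist p.1 q.1 - f q.2| < e / 2)%R.
  move=> Sq; rewrite -lte_fin; apply: le_lt_trans fg.
  by apply: ereal_sup_ubound; exists q.
have := lt _ Sp; have := lt _ Sp'; rewrite qdistxx !ltr_distl.
have := Lf p.2 p'.2; lra.
Qed.

Lemma closed_measurable X Y (S : set (X * Y)) :
  closed S -> measurable (S : set (borel (X * Y)%type)).
Proof.
move=> cS; rewrite -[S]setCK; apply: measurableC; apply: sub_sigma_algebra.
by rewrite openC.
Qed.

Lemma box_lt_coupling X Y (e : R) : box X Y < e%:E ->
  exists (pi : probability (borel (X * Y)%type) R) (S : set (X * Y)),
  [/\ coupling pi, closed S, pi (~` S) < e%:E & distortion_le S e].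
Proof.
move=> /ereal_inf_lt[_ [pi [S [cpi cS ->]]]]; rewrite gt_max => /andP[piS HS].
exists pi, S; split => //; last exact: lip_hausdorff_distortion.
by rewrite probability_setC//; exact: closed_measurable.
Qed.

End distortion.

(** * Borel sets of separable metric spaces *)

Section borel.
Variable R : realType.
Implicit Types X Y Z : qmSpace R.

Lemma mdist_ball_open (M : completeMetricType R) (x : M) (r : R) :
  open [set y | mdist x y < r].
Proof.
rewrite openE => y /= xy.
apply/metricType_numDomainType.nbhs_mdistP.
exists (r - mdist x y) => /=; first by rewrite subr_gt0.
by move=> z /= yz; have := metric_triangle x y z; lra.
Qed.

Lemma natSinv_lt (e : R) : 0 < e -> exists n : nat, n.+1%:R^-1 < e.
Proof.
by move=> e0; have [n _ /(_ n (leqnn n))] := near_infty_natSinv_lt (PosNum e0);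
  exists n.
Qed.

(** Every open set is a countable union of balls with radii 1 / (k + 1) around
the points of a dense sequence. *)
Lemma measurable_to_borel (M : completeMetricType R) d (T : measurableType d)
    (f : T -> M) (x : nat -> M) :
  (forall z (e : R), 0 < e -> exists n, mdist z (x n) < e) ->
  (forall n (r : R), measurable [set t | mdist (x n) (f t) < r]) ->
  measurable_fun setT (f : T -> borel M).
Proof.
move=> dx mx; apply: (@measurability _ _ T (borel M) setT _ open) => //.
move=> _ [U oU <-]; rewrite setTI.
pose P n k := forall u, mdist (x n) u < k.+1%:R^-1 -> U u.
have -> : f @^-1` U = \bigcup_n \bigcup_k
   (if `[< P n k >] then [set t | mdist (x n) (f t) < k.+1%:R^-1] else set0).
  apply/seteqP; split=> [t /= Ut|t [n _ [k _]]]; last first.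
    by case: asboolP => // Pn /= h; exact: Pn.
  have /metricType_numDomainType.nbhs_mdistP[e /= e0 eU] : nbhs (f t) U.
    by apply: open_nbhs_nbhs; split.
  have [k ke] : exists k : nat, k.+1%:R^-1 < e / 2.
    by apply: natSinv_lt; rewrite divr_gt0.
  have k0 : 0 < k.+1%:R^-1 :> R by rewrite invr_gt0.
  have [n xn] := dx (f t) _ k0.
  exists n => //; exists k => //; case: asboolP => [_|[]].
    by rewrite /= metric_sym.
  move=> u xu; apply: eU => /=; have := metric_triangle (f t) (x n) u.
  by move: (k.+1%:R^-1) ke xn xu => r; lra.
apply: bigcup_measurable => n _; apply: bigcup_measurable => k _.
by case: ifP => _.
Qed.

Lemma dense_sequence X :
  exists x : nat -> X, forall z (e : R), 0 < e -> exists n, mdist z (x n) < e.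
Proof.
have [D cD dD] := qm_separable X.
have approx z (e : R) : 0 < e -> exists2 x, D x & mdist z x < e.
  move=> e0; have [||x [/interior_subset zx Dx]] := dD (interior (ball z e)).
  - by exists z; exact: nbhsx_ballx.
  - exact: open_interior.
  by exists x => //; move: zx; rewrite ballEmdist.
case/pfcard_geP: cD => [D0|[x]].
  by have [x] := approx point 1 ltr01; rewrite D0.
exists x => z e e0; have [y Dy zy] := approx z e e0.
by have [n _ xn] := @surj _ _ _ _ x y Dy; exists n; rewrite xn.
Qed.

Lemma borel_mdist_lt X d (T : measurableType d) (f : T -> X) (x : X) (r : R) :
  measurable_fun setT (f : T -> borel X) ->
  measurable [set t | mdist x (f t) < r].
Proof.
move=> mf; rewrite -[X in measurable X]setTI.
apply: (mf measurableT [set y | mdist x y < r]).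
by apply: sub_sigma_algebra; exact: mdist_ball_open.
Qed.

(** The Borel sigma-algebra of the product is generated by countably many
rectangles of balls, by separability of both factors. *)
Lemma measurable_pair_borel X Y d (T : measurableType d)
    (f : T -> X) (g : T -> Y) :
  measurable_fun setT (f : T -> borel X) ->
  measurable_fun setT (g : T -> borel Y) ->
  measurable_fun setT ((fun t => (f t, g t)) : T -> borel (X * Y)%type).
Proof.
move=> mf mg.
apply: (@measurability _ _ T (borel (X * Y)%type) setT _ open) => //.
move=> _ [U oU <-]; rewrite setTI.
have [x hx] := dense_sequence X; have [y hy] := dense_sequence Y.
pose r n : R := n.+1%:R^-1.
pose B n i j := [set t | mdist (x i) (f t) < r n] `&`
                [set t | mdist (y j) (g t) < r n].
pose P n i j := forall u v, mdist (x i) u < r n -> mdist (y j) v < r n ->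
   U (u, v).
have -> : (fun t => (f t, g t)) @^-1` U = \bigcup_n \bigcup_i \bigcup_j
   (if `[< P n i j >] then B n i j else set0).
  apply/seteqP; split=> [t /= Ut|t [n _ [i _ [j _]]]]; last first.
    by case: asboolP => // Pn [/= h1 h2]; exact: Pn.
  have /nbhs_ballP[e /= e0 eU] : nbhs (f t, g t) U by exact: oU.
  have [n ne] : exists n, 2 * r n < e.
    have e2 : 0 < e / 2 by rewrite divr_gt0.
    by have [n] := natSinv_lt e2; rewrite -/(r n) => rn; exists n; move: (r n) rn => q rn; lra.
  have rn0 : 0 < r n by rewrite invr_gt0.
  have [i xi] := hx (f t) _ rn0; have [j yj] := hy (g t) _ rn0.
  exists n => //; exists i => //; exists j => //.
  case: asboolP => [_|[]]; first by split => /=; rewrite metric_sym.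
  move=> u v xu yv; apply: eU; split; rewrite /= ballEmdist /=.
    have := metric_triangle (f t) (x i) u; lra.
  have := metric_triangle (g t) (y j) v; lra.
apply: bigcup_measurable => n _; apply: bigcup_measurable => i _.
apply: bigcup_measurable => j _; case: ifP => _ //.
by apply: measurableI; exact: borel_mdist_lt.
Qed.

(** The closed set that witnesses the bound is the closure of the image of E. *)
Lemma box_le X Y d (T : measurableType d) (P : probability T R)
    (f : T -> X) (g : T -> Y) (E : set T) (e : R) :
  measurable_fun setT (f : T -> borel X) ->
  measurable_fun setT (g : T -> borel Y) ->
  (forall A : set (borel X), measurable A -> P (f @^-1` A) = qm_measure X A) ->
  (forall A : set (borel Y), measurable A -> P (g @^-1` A) = qm_measure Y A) ->
  measurable E -> (P (~` E) <= e%:E)%E -> 0 <= e ->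
  (forall s t, E s -> E t ->
    `|qdist (f s) (f t) - qdist (g s) (g t)| <= e) ->
  (box X Y <= e%:E)%E.
Proof.
move=> mf mg fP gP mE PE e0 dE.
pose F t := (f t, g t).
have mF : measurable_fun setT (F : T -> borel (X * Y)%type).
  exact: measurable_pair_borel.
pose HF := isMeasurableFun.Build _ _ T (borel (X * Y)%type) F mF.
pose Fm : {mfun T >-> borel (X * Y)%type} := HB.pack F HF.
pose pi : probability (borel (X * Y)%type) R := distribution P Fm.
have piE A : pi A = P (F @^-1` A) by [].
pose S := closure (F @` E).
have cS : closed S by exact: closed_closure.
have mS : measurable (S : set (borel (X * Y)%type)).
  exact: closed_measurable.
apply: (@le_trans _ _ (maxe (1 - pi S) (2%:E * lip_hausdorff S))%E).
  apply: ereal_inf_lbound; exists pi, S; split => //.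
rewrite ge_max; apply/andP; split; last first.
  apply: lip_hausdorff_le => //; apply: distortion_closure.
  by move=> _ _ [s Es <-] [t Et <-]; exact: dE.
rewrite -probability_setC// piE (le_trans _ PE)// le_measure ?inE//.
- rewrite -[X in measurable X]setTI; apply: (mF) => //; exact: measurableC.
- exact: measurableC.
- by move=> t /= nS Et; apply: nS; apply: subset_closure; exists t.
Qed.

End borel.

(** * Couplings with a prescribed joint law of labels *)

Section gluing.
Variable R : realType.

Lemma measurable_label d (T : measurableType d) (a : T -> nat) i :
  measurable_fun setT a -> measurable (a @^-1` [set i]).
Proof. by move=> ma; rewrite -[X in measurable X]setTI; exact: ma. Qed.

Lemma measure_label_sum d (T : measurableType d)
    (P : {measure set T -> \bar R}) (a : T -> nat) (n : nat) (A : set T) :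
  measurable_fun setT a -> (forall t, (a t < n)%N) -> measurable A ->
  P A = (\sum_(i < n) P (A `&` a @^-1` [set (i : nat)]))%E.
Proof.
move=> ma an mA.
rewrite -(@measure_bigsetU_ord _ _ _ P n xpredT
  (fun i => A `&` a @^-1` [set (i : nat)])).
- congr (P _); rewrite -(bigcup_mkord n (fun i => A `&` a @^-1` [set i])).
  by apply/seteqP; split=> [t At|t [i _ []//]]; exists (a t) => //=.
- by move=> i; apply: measurableI => //; exact: measurable_label.
- by move=> i j _ _ [t [[_ /= ai] [_ /= aj]]]; apply/ord_inj; rewrite -ai -aj.
Qed.

Section glue.
Variables (d1 d2 : measure_display) (T1 : measurableType d1)
  (T2 : measurableType d2) (P1 : probability T1 R) (P2 : probability T2 R)
  (a : T1 -> nat) (b : T2 -> nat) (n : nat) (p : nat -> nat -> R).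
Hypotheses (ma : measurable_fun setT a) (mb : measurable_fun setT b)
  (an : forall t, (a t < n)%N) (bn : forall t, (b t < n)%N)
  (p0 : forall i j, 0 <= p i j)
  (pa : forall i, (i < n)%N ->
    P1 (a @^-1` [set i]) = (\sum_(j < n) p i j)%:E)
  (pb : forall j, (j < n)%N ->
    P2 (b @^-1` [set j]) = (\sum_(i < n) p i j)%:E).

Let r i := \sum_(j < n) p i j.
Let s j := \sum_(i < n) p i j.
Let r0 i : 0 <= r i. Proof. exact: sumr_ge0. Qed.
Let s0 j : 0 <= s j. Proof. exact: sumr_ge0. Qed.
(* The joint law must have mass [p i j] on [cell i j], where the product measure
   has mass [r i * s j]; a vanishing denominator forces [p i j] to vanish, so the
   convention on division by 0 is harmless. *)
Let c i j := p i j / (r i * s j).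
Let c0 i j : 0 <= c i j. Proof. by rewrite divr_ge0// mulr_ge0. Qed.

Let cell i j : set (T1 * T2) := (a @^-1` [set i]) `*` (b @^-1` [set j]).
Let mcell i j : measurable (cell i j).
Proof. by apply: measurableX; exact: measurable_label. Qed.

Let glue_row i := msum (fun j => mscale (NngNum (c0 i j))
  (mrestr (P1 \x P2)%E (mcell i j))) n.

Let glue := msum glue_row n.

Let u U i := fine (P1 (U `&` a @^-1` [set i])).
Let v V j := fine (P2 (V `&` b @^-1` [set j])).

Let glueE U V : measurable U -> measurable V ->
  glue (U `*` V) = (\sum_(i < n) \sum_(j < n) c i j * (u U i * v V j))%:E.
Proof.
move=> mU mV; rewrite /glue /msum -sumEFin; apply: eq_bigr => i _.
rewrite /glue_row /msum -sumEFin; apply: eq_bigr => j _.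
have mUa : measurable (U `&` a @^-1` [set (i : nat)]).
  by apply: measurableI => //; exact: measurable_label.
have mVb : measurable (V `&` b @^-1` [set (j : nat)]).
  by apply: measurableI => //; exact: measurable_label.
transitivity ((c i j)%:E * (P1 \x P2)%E
    ((U `&` a @^-1` [set (i : nat)]) `*` (V `&` b @^-1` [set (j : nat)])))%E.
  rewrite /mscale /mrestr /cell /=; congr (_ * (P1 \x P2) _)%E.
  exact/esym/setXI.
rewrite product_measure1E// [RHS]EFinM; congr (_ * _)%E.
by rewrite EFinM !fineK ?fin_num_measure.
Qed.

Let p_le_r i j : (j < n)%N -> p i j <= r i.
Proof.
move=> jn; rewrite /r (bigD1 (Ordinal jn))//= lerDl.
exact: sumr_ge0.
Qed.

Let p_le_s i j : (i < n)%N -> p i j <= s j.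
Proof.
move=> jn; rewrite /s (bigD1 (Ordinal jn))//= lerDl.
exact: sumr_ge0.
Qed.

Let c_r i j : (i < n)%N -> (j < n)%N -> c i j * s j = p i j / r i.
Proof.
move=> ilt jlt; rewrite /c; have [sj|sj] := eqVneq (s j) 0.
  have -> : p i j = 0 by apply/eqP; rewrite eq_le p0 -sj p_le_s.
  by rewrite !mul0r.
by rewrite invfM mulrA divfK.
Qed.

Let c_s i j : (i < n)%N -> (j < n)%N -> c i j * r i = p i j / s j.
Proof.
move=> ilt jlt; rewrite /c; have [sj|sj] := eqVneq (r i) 0.
  have -> : p i j = 0 by apply/eqP; rewrite eq_le p0 -sj p_le_r.
  by rewrite !mul0r.
by rewrite invfM [(r i)^-1 * _]mulrC mulrA divfK.
Qed.

Let uT i : (i < n)%N -> u setT i = r i.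
Proof. by move=> ilt; rewrite /u setTI pa. Qed.

Let vT i : (i < n)%N -> v setT i = s i.
Proof. by move=> ilt; rewrite /v setTI pb. Qed.

Let u_r U i : measurable U -> (i < n)%N -> r i = 0 -> u U i = 0.
Proof.
move=> mU ilt ri.
have : (P1 (U `&` a @^-1` [set i]) <= (r i)%:E)%E.
  rewrite -pa//; apply: le_measure; rewrite ?inE//.
  - by apply: measurableI => //; exact: measurable_label.
  - exact: measurable_label.
by rewrite ri measure_le0 /u => /eqP ->.
Qed.

Let v_s U i : measurable U -> (i < n)%N -> s i = 0 -> v U i = 0.
Proof.
move=> mU ilt ri.
have : (P2 (U `&` b @^-1` [set i]) <= (s i)%:E)%E.
  rewrite -pb//; apply: le_measure; rewrite ?inE//.
  - by apply: measurableI => //; exact: measurable_label.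
  - exact: measurable_label.
by rewrite ri measure_le0 /v => /eqP ->.
Qed.

Let sum_u U : measurable U -> P1 U = (\sum_(i < n) u U i)%:E.
Proof.
move=> mU; rewrite (measure_label_sum P1 ma an mU) -sumEFin.
apply: eq_bigr => i _; rewrite fineK// fin_num_measure//.
by apply: measurableI => //; exact: measurable_label.
Qed.

Let sum_v U : measurable U -> P2 U = (\sum_(i < n) v U i)%:E.
Proof.
move=> mU; rewrite (measure_label_sum P2 mb bn mU) -sumEFin.
apply: eq_bigr => i _; rewrite fineK// fin_num_measure//.
by apply: measurableI => //; exact: measurable_label.
Qed.

Let glue_fst U : measurable U -> glue (U `*` setT) = P1 U.
Proof.
move=> mU; rewrite glueE// sum_u//; congr EFin; apply: eq_bigr => i _.
rewrite (eq_bigr (fun j : 'I_n => u U i / r i * p i j)).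
  rewrite -mulr_sumr -/(r i); have [ri|ri] := eqVneq (r i) 0.
    by rewrite ri mulr0 u_r.
  by rewrite divfK.
by move=> j _; rewrite vT// mulrCA c_r// [p i j / _]mulrC mulrA.
Qed.

Let glue_snd V : measurable V -> glue (setT `*` V) = P2 V.
Proof.
move=> mV; rewrite glueE// sum_v//; congr EFin; rewrite exchange_big/=.
apply: eq_bigr => j _.
rewrite (eq_bigr (fun i : 'I_n => v V j / s j * p i j)).
  rewrite -mulr_sumr -/(s j); have [sj|sj] := eqVneq (s j) 0.
    by rewrite sj mulr0 v_s.
  by rewrite divfK.
by move=> i _; rewrite uT// mulrA c_s// mulrC [p i j / _]mulrC mulrA.
Qed.

Let glue_setT : glue setT = 1%E.
Proof. by rewrite -setXTT glue_fst// probability_setT. Qed.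

HB.instance Definition _ := Measure.on glue.
HB.instance Definition _ := Measure_isProbability.Build _ _ _ glue glue_setT.

(** The labels are independent of everything else in both spaces, conditionally
on their values: on each cell the coupling is a multiple of the product
measure. *)
Lemma gluing : exists Q : probability (T1 * T2)%type R,
  [/\ forall A, measurable A -> Q (fst @^-1` A) = P1 A,
      forall A, measurable A -> Q (snd @^-1` A) = P2 A &
      forall i j, (i < n)%N -> (j < n)%N ->
        Q [set t | a t.1 = i /\ b t.2 = j] = (p i j)%:E].
Proof.
exists glue; split=> [A mA|A mA|i j ilt jlt].
- rewrite -[RHS]glue_fst//; congr (glue _).
  by apply/seteqP; split=> -[x y] //= [].
- rewrite -[RHS]glue_snd//; congr (glue _).
  by apply/seteqP; split=> -[x y] //= [].
- transitivity (glue (cell i j)).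
    by congr (glue _); apply/seteqP; split=> -[x y].
  rewrite glueE; [|exact: measurable_label..]; congr EFin.
  rewrite (bigD1 (Ordinal ilt))//= [X in _ + X]big1 ?addr0.
    rewrite (bigD1 (Ordinal jlt))//= [X in _ + X]big1 ?addr0.
      rewrite /u /v !setIid pa// pb//= -/(r i) -/(s j) mulrA c_s//.
      have [sj|sj] := eqVneq (s j) 0; last by rewrite divfK.
      by rewrite sj mulr0; apply/eqP; rewrite eq_le p0 -sj p_le_s.
    move=> k kj; rewrite /v (_ : _ `&` _ = set0) ?measure0 ?mulr0//.
    apply/seteqP; split=> // t [/= -> /= jk]; move/negP : kj; apply.
    by apply/eqP/val_inj.
  move=> k ki; rewrite big1// => l _.
  rewrite /u (_ : _ `&` _ = set0) ?measure0 ?mul0r ?mulr0//.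
  apply/seteqP; split=> // t [/= -> /= jk]; move/negP : ki; apply.
  by apply/eqP/val_inj.
Qed.

End glue.
End gluing.

(** * Finite labellings of a qm-space *)

Section labels.
Variable R : realType.

Lemma measurable_labelP d (T : measurableType d) (a : T -> nat) :
  (forall i, measurable (a @^-1` [set i])) -> measurable_fun setT a.
Proof.
move=> ma _ Y _; rewrite setTI (_ : a @^-1` Y = \bigcup_(i in Y) (a @^-1` [set i])).
  by apply: bigcup_measurable.
by apply/seteqP; split=> [t Yt|t [i Yi /= ->]//]; exists (a t).
Qed.

Lemma measurable_label_le d (T : measurableType d) (a : T -> nat) :
  (forall i, measurable [set t | (i <= a t)%N]) -> measurable_fun setT a.
Proof.
move=> ma; apply: measurable_labelP => i.
rewrite (_ : _ @^-1` _ = [set t | (i <= a t)%N] `\` [set t | (i.+1 <= a t)%N]).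
  exact: measurableD.
apply/seteqP; split=> [t /= ->|t /= [h1 /negP]]; first by rewrite ltnn.
by rewrite -leqNgt => h2; apply/eqP; rewrite eqn_leq h2.
Qed.

Lemma measure_lt_bigcap0 d (T : measurableType d) (P : probability T R)
    (F : nat -> set T) (e : R) :
  (forall n, measurable (F n)) -> (forall m n, (m <= n)%N -> F n `<=` F m) ->
  \bigcap_n F n = set0 -> 0 < e -> exists n, (P (F n) < e%:E)%E.
Proof.
move=> mF niF F0 e0.
have : P \o F @ \oo --> P (\bigcap_n F n).
  apply: nonincreasing_cvg_mu => //.
  - by rewrite (le_lt_trans (probability_le1 _ _))// ltry.
  - by apply: bigcap_measurable.
  - by move=> m n mn; apply/subsetPset; exact: niF.
rewrite F0 measure0 => cF.
have : \forall n \near \oo, (P (F n) < e%:E)%E.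
  apply: (cF [set x | (x < e%:E)%E]); apply: open_nbhs_nbhs.
  by split; [exact: open_ereal_lt_ereal|rewrite /= lte_fin].
by case=> n _ /(_ n (leqnn n)) /= Fn; exists n.
Qed.

(** The label of x is the index of the first ball of radius e, among the first
n balls around a dense sequence, that contains x, and n if there is none. *)
Lemma labelling (X : qmSpace R) (e : R) : 0 < e ->
  exists (n : nat) (y : nat -> X) (a : X -> nat) (G : set (borel X)),
  [/\ measurable_fun setT (a : borel X -> nat), forall x, (a x <= n)%N,
      measurable G, (qm_measure X (~` G) < e%:E)%E &
      forall x, G x -> mdist x (y (a x)) < e].
Proof.
move=> e0; have [y hy] := dense_sequence X.
pose B k : set (borel X) := [set z | mdist (y k) z < e].
have mB k : measurable (B k).
  apply: (@borel_mdist_lt R X _ (borel X) idfun) => //; exact: measurable_id.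
pose F n := \bigcap_(k in [set k | (k < n)%N]) ~` B k.
have mF n : measurable (F n).
  by apply: bigcap_measurableType => k _; exact: measurableC.
have [n Fn] : exists n, (qm_measure X (F n) < e%:E)%E.
  apply: measure_lt_bigcap0 => //.
    by move=> m n mn z Fz k /= km; apply: Fz; exact: leq_trans mn.
  apply/seteqP; split=> // z Fz; have [k zk] := hy z e e0.
  by apply: (Fz k.+1 I k) => //=; rewrite /B/= metric_sym.
pose a z := find (fun k => mdist (y k) z < e) (iota 0 n).
have aF i z : (i <= n)%N -> (i <= a z)%N <-> F i z.
  move=> iln; split=> [ia k /= ki|Fz].
    have := @before_find _ 0%N (fun k => mdist (y k) z < e) (iota 0 n) k
      (leq_trans ki ia).
    by rewrite nth_iota ?(leq_trans ki)//= add0n /B/= => ->.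
  rewrite leqNgt; apply/negP => ai.
  have h : has (fun k => mdist (y k) z < e) (iota 0 n).
    by rewrite has_find size_iota (leq_trans ai).
  have := nth_find 0%N h; rewrite -/(a z) nth_iota ?(leq_trans ai)// add0n.
  exact: Fz.
exists n, y, a, (~` F n); split.
- apply: measurable_label_le => i; have [iln|nli] := leqP i n.
    rewrite (_ : [set _ | _] = F i) => //.
    by apply/seteqP; split=> z /aF; apply.
  rewrite (_ : [set _ | _] = set0)//; apply/seteqP; split=> // z /= ia.
  by have := leq_trans nli ia; rewrite ltnNge -[X in (_ <= X)%N](size_iota 0 n) find_size.
- by move=> x; rewrite -[X in (_ <= X)%N](size_iota 0 n) find_size.
- exact: measurableC.
- by rewrite setCK.
- move=> x Fx; have {Fx} : (a x < n)%N.
    by rewrite ltnNge; apply/negP => na; apply: Fx; apply/aF.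
  move=> an; have h : has (fun k => mdist (y k) x < e) (iota 0 n).
    by rewrite has_find size_iota.
  by have := nth_find 0%N h; rewrite -/(a x) nth_iota// add0n metric_sym.
Qed.

End labels.

(** * Cutting the unit interval *)

Section divisible.
Variable R : realType.

Definition divisible d (T : measurableType d) (P : probability T R) :=
  forall (A : set T) (c : R), measurable A -> 0 <= c -> (c%:E <= P A)%E ->
  exists B, [/\ measurable B, B `<=` A & P B = c%:E].

Lemma divisible_split d (T : measurableType d) (P : probability T R) n
    (A : set T) (p : nat -> R) :
  divisible P -> measurable A -> (forall j, 0 <= p j) ->
  P A = (\sum_(j < n.+1) p j)%:E ->
  exists psi : T -> nat, [/\ measurable_fun setT psi,
    forall t, (psi t <= n)%N &
    forall j, (j <= n)%N -> P (A `&` psi @^-1` [set j]) = (p j)%:E].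
Proof.
move=> divP + p0; elim: n A => [|n IHn] A mA PA.
  exists (fun=> 0%N); split => // j; rewrite leqn0 => /eqP ->.
  rewrite (_ : _ `&` _ = A) ?PA ?big_ord1//.
  by apply/seteqP; split=> // t [].
have [| |B [mB BA PB]] := divP A (\sum_(j < n.+1) p j) mA.
- exact: sumr_ge0.
- by rewrite PA lee_fin [leRHS]big_ord_recr/= lerDl.
have [psi [mpsi psin psip]] := IHn B mB PB.
pose psi' t := if t \in B then psi t else n.+1.
have E j : (j <= n)%N -> psi' @^-1` [set j] = B `&` psi @^-1` [set j].
  move=> jn; apply/seteqP; split=> t /=; rewrite /psi'.
    case: ifPn => [/set_mem //|_ jE]; move: jn; rewrite -jE; by rewrite ltnn.
  by move=> [/mem_set ->].
have E' : psi' @^-1` [set n.+1] = ~` B.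
  apply/seteqP; split=> t /=; rewrite /psi'.
    by case: ifPn => [_ tE|/negP nB _ /mem_set//]; have := psin t; rewrite tE ltnn.
  by case: ifPn => // /set_mem.
exists psi'; split.
- apply: measurable_labelP => i; have [iln|] := leqP i n.
    by rewrite E//; apply: measurableI => //; exact: measurable_label.
  rewrite leq_eqVlt => /orP[/eqP<-|ni]; first by rewrite E'; exact: measurableC.
  rewrite (_ : _ @^-1` _ = set0)//; apply/seteqP; split=> // t /= ti.
  move: ni; rewrite -ti /psi'; case: ifP; rewrite ?ltnn// => _.
  by rewrite ltnNge (leq_trans (psin t)).
- by move=> t; rewrite /psi'; case: ifP => // _; rewrite (leq_trans (psin t)).
- move=> j; rewrite leq_eqVlt => /orP[/eqP->|jn].
    rewrite E' -setDE measureD//; last by rewrite -ge0_fin_numE// fin_num_measure.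
    rewrite (_ : A `&` B = B); last by apply/setIidPr.
    transitivity ((\sum_(j < n.+2) p j)%:E - (\sum_(j < n.+1) p j)%:E)%E.
      by rewrite -PA -PB.
    rewrite -EFinB; congr EFin.
    by rewrite big_ord_recr/= addrAC subrr add0r.
  rewrite E// setIA (_ : A `&` B = B) ?psip//; exact/setIidPr.
Qed.

(** Each level set of phi is cut into pieces of the prescribed masses, so that
one more step of a chain with given joint laws can always be realized. *)
Lemma divisible_joint d (T : measurableType d) (P : probability T R) n m
    (phi : T -> nat) (p : nat -> nat -> R) :
  divisible P -> measurable_fun setT phi -> (forall t, (phi t <= n)%N) ->
  (forall i j, 0 <= p i j) ->
  (forall i, (i <= n)%N ->
    P (phi @^-1` [set i]) = (\sum_(j < m.+1) p i j)%:E) ->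
  exists psi : T -> nat, [/\ measurable_fun setT psi,
    forall t, (psi t <= m)%N &
    forall i j, (i <= n)%N -> (j <= m)%N ->
      P [set t | phi t = i /\ psi t = j] = (p i j)%:E].
Proof.
move=> divP mphi phin p0 Pphi.
have /choice[psi hpsi] i : exists psi : T -> nat, (i <= n)%N ->
    [/\ measurable_fun setT psi, forall t, (psi t <= m)%N &
    forall j, (j <= m)%N ->
      P (phi @^-1` [set i] `&` psi @^-1` [set j]) = (p i j)%:E].
  have [iln|nli] := leqP i n; last by exists (fun=> 0%N).
  have [psi hpsi] := divisible_split divP (measurable_label i mphi) (p0 i)
    (Pphi i iln).
  by exists psi.
exists (fun t => psi (phi t) t); split.
- apply: measurable_labelP => j.
  rewrite (_ : _ @^-1` _ = \bigcup_(i in [set i | (i <= n)%N])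
    (phi @^-1` [set i] `&` psi i @^-1` [set j])).
    apply: bigcup_measurable => i iln; apply: measurableI; apply: measurable_label => //.
    by have [] := hpsi i iln.
  apply/seteqP; split=> [t /= tj|t [i _ [/= -> ->]]//].
  by exists (phi t) => //=.
- by move=> t; have [_ +] := hpsi _ (phin t); exact.
- move=> i j iln jm; have [_ _ /(_ j jm) <-] := hpsi i iln.
  by congr (P _); apply/seteqP; split=> t /= [->].
Qed.

End divisible.

Section uniform.
Variable R : realType.

Definition unit_lebesgue : set (measurableTypeR R) -> \bar R :=
  mrestr (@lebesgue_measure R) (measurable_itv `[0, 1]).

HB.instance Definition _ := Measure.on unit_lebesgue.

Let unit_lebesgueT : unit_lebesgue setT = 1%E.
Proof.
by rewrite /unit_lebesgue/mrestr setTI lebesgue_measure_itv/= lte_fin ltr01 oppr0 adde0.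
Qed.

HB.instance Definition _ :=
  Measure_isProbability.Build _ _ _ unit_lebesgue unit_lebesgueT.

(** The measure of the part of A below t is a 1-Lipschitz function of t, which
takes every value between 0 and the measure of A. *)
Lemma divisible_unit_lebesgue :
  divisible (unit_lebesgue : probability (measurableTypeR R) R).
Proof.
move=> A c mA c0 cA.
pose P := unit_lebesgue : probability (measurableTypeR R) R.
pose F t := fine (P (A `&` `]-oo, t])).
have mI t : measurable (A `&` `]-oo, t] : set (measurableTypeR R)).
  by apply: measurableI => //; exact: measurable_itv.
have FE t : (F t)%:E = P (A `&` `]-oo, t]) by rewrite fineK// fin_num_measure.
have Flip s t : s <= t -> `|F t - F s| <= t - s.
  move=> st; have : (P (A `&` `]-oo, t]) <= P (A `&` `]-oo, s]) + (t - s)%:E)%E.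
    have -> : A `&` `]-oo, t] = (A `&` `]-oo, s]) `|` (A `&` `]s, t]).
      rewrite -setIUr -itv_bndbnd_setU//.
    apply: (le_trans (measureU2 _ _ _)) => //.
      by apply: measurableI => //; exact: measurable_itv.
    apply: leeD2l; rewrite /P/= /unit_lebesgue/mrestr.
    apply: (@le_trans _ _ (lebesgue_measure `]s, t]%classic)).
      apply: le_measure; rewrite ?inE//.
      - by apply: measurableI => //; apply: measurableI => //; exact: measurable_itv.
      - by move=> x [[]].
    by rewrite lebesgue_measure_itv/= lte_fin; case: ifP => // _; rewrite lee_fin subr_ge0.
  have : (P (A `&` `]-oo, s]) <= P (A `&` `]-oo, t]))%E.
    apply: le_measure; rewrite ?inE//.
    by apply: setIS; apply: subset_itvl; rewrite bnd_simp.
  rewrite -!FE -EFinD !lee_fin ler_norml; lra.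
have cF : continuous F.
  move=> t; apply/cvgrPdist_le => e e0.
  near=> s; have : `|t - s| <= e by near: s; exact: cvgr_dist_le.
  apply: le_trans; have [st|ts] := leP t s.
    by rewrite distrC [leRHS]distrC (le_trans (Flip _ _ st))// ler_norm.
  by rewrite (le_trans (Flip _ _ (ltW ts)))// ler_norm.
have F0 : F (-1) = 0.
  rewrite /F/= /P/= /unit_lebesgue/mrestr.
  rewrite (_ : _ `&` _ = set0) ?measure0//.
  apply/seteqP; split=> // x [[_ /=]]; rewrite !in_itv/= => x1 /andP[x0 _].
  by lra.
have F1 : (F 1)%:E = P A.
  rewrite FE /P/= /unit_lebesgue/mrestr; congr (lebesgue_measure _).
  by apply/seteqP; split=> x /= [] => [[]|] //; rewrite !in_itv/= => ? /andP[-> ->].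
have [|||t _ Ft] := @IVT _ F (-1) 1 c.
- lra.
- exact: continuous_subspaceT.
- have Fc : c <= F 1 by rewrite -lee_fin F1.
  by rewrite F0 min_l ?max_r ?c0 ?Fc// (le_trans c0).
by exists (A `&` `]-oo, t]); split => //; rewrite -Ft FE.
Unshelve. all: by end_near.
Qed.

End uniform.

(** * The qm-space defined by a quasi-pseudometric on a probability space *)

Lemma enumeration (I : countType) (T : Type) (f : I -> T) (t0 : T) :
  exists g : nat -> T, (forall n, g n = t0 \/ exists i, g n = f i) /\
    forall i, exists n, g n = f i.
Proof.
exists (fun n => if unpickle n is Some i then f i else t0).
split=> [n|i]; last by exists (pickle i); rewrite pickleK.
by case: unpickle => [i|]; [right; exists i|left].
Qed.

Section realization.
Variables (R : realType) (d : measure_display) (T : measurableType d)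
  (P : probability T R) (D : T -> T -> R).
Hypotheses (D0 : forall u v, 0 <= D u v)
  (Dtri : forall u v w, D u w <= D u v + D v w).

Definition sym_dist u v := Num.max (D u v) (D v u).
Local Notation Ds := sym_dist.

Hypotheses (mD : forall u r, measurable [set v | Ds u v < r])
  (c : nat -> T) (cP : forall u (e : R), 0 < e -> exists n, Ds u (c n) < e).

Let B u r := [set v | Ds u v < r].

Let DsC u v : Ds u v = Ds v u. Proof. by rewrite /Ds maxC. Qed.

Let D_le u v : D u v <= Ds u v. Proof. by rewrite le_max lexx. Qed.

Let D_le' u v : D u v <= Ds v u. Proof. by rewrite DsC. Qed.

Let Ds_tri v u w : Ds u w <= Ds u v + Ds v w.
Proof.
rewrite ge_max; have := Dtri u v w; have := Dtri w v u.
have := D_le u v; have := D_le v w; have := D_le' v u; have := D_le' w v.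
by move=> *; apply/andP; split; lra.
Qed.

(** The profile of u is the sequence of the numbers [D (c n) u]. The predicate
selects the uniform limits of profiles all of whose neighbourhoods have
positive measure. A sequence indexed by nat, rather than a function on T, is
enough because c is dense, and it keeps the universe of the carrier
independent of that of T. *)
Definition profile_pred (f : nat -> R) := forall e : R, 0 < e ->
  exists u, (0 < P [set v | (Ds u v < e)%R])%E /\ forall n, `|f n - D (c n) u| <= e.

Definition profile := {f : nat -> R | profile_pred f}.

Let profile_ext (f g : profile) : (forall w, sval f w = sval g w) -> f = g.
Proof.
move: f g => [f Kf] [g Kg] /= fg.
have E : f = g by exact/funext.
by move: Kf; rewrite E => Kf; congr exist; exact: Prop_irrelevance.
Qed.

(* The value 0 is added so that the supremum is nonnegative. *)
Let diffs (f g : profile) : set R :=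
  [set x | x = 0 \/ exists w, x = sval g w - sval f w].

Let diffs_bound f g : has_ubound (diffs f g).
Proof.
have [u [_ fu]] := svalP f 1 ltr01; have [v [_ gv]] := svalP g 1 ltr01.
exists (2 + Ds u v) => _ [->|[w ->]].
  by have := D0 u v; have := D_le u v; lra.
have := fu w; have := gv w; rewrite !ler_norml.
have := Dtri (c w) u v; have := D_le u v; lra.
Qed.

(** This is an asymmetric version of the uniform distance; on profiles it gives
back D, by the triangle inequality and the density of c. *)
Definition profile_qdist f g : R := sup (diffs f g).
Local Notation qd := profile_qdist.

Let qd_leP f g r : reflect (0 <= r /\ forall w, sval g w - sval f w <= r)
  (qd f g <= r).
Proof.
apply: (iffP idP) => [qr|[r0 fr]].
  split=> [|w]; apply: le_trans qr; apply: ub_le_sup => //; first by left.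
  by right; exists w.
by apply: ge_sup => [|_ [->//|[w ->]]]; [exists 0; left|exact: fr].
Qed.

Let qd0 f g : 0 <= qd f g.
Proof. by case/qd_leP: (lexx (qd f g)). Qed.

Let qdE f g w : sval g w - sval f w <= qd f g.
Proof. by case/qd_leP: (lexx (qd f g)). Qed.

Let qdxx f : qd f f = 0.
Proof.
apply/eqP; rewrite eq_le qd0 andbT; apply/qd_leP; split => // w.
by rewrite subrr.
Qed.

Let qd_tri f g h : qd f h <= qd f g + qd g h.
Proof.
apply/qd_leP; split=> [|w]; first exact: addr_ge0.
have := qdE f g w; have := qdE g h w; lra.
Qed.

Definition profile_mdist f g := Num.max (qd f g) (qd g f).
Local Notation md := profile_mdist.

Let md_leP f g r : reflect (0 <= r /\ forall w, `|sval f w - sval g w| <= r)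
  (md f g <= r).
Proof.
rewrite ge_max; apply: (iffP andP) => [[/qd_leP[r0 h] /qd_leP[_ h']]|[r0 h]].
  by split=> // w; rewrite ler_norml; have := h w; have := h' w; lra.
by split; apply/qd_leP; split=> // w; have := h w; rewrite ler_norml; lra.
Qed.

Let mdxx f : md f f = 0. Proof. by rewrite /md qdxx maxxx. Qed.

Let md_positivity f g : md f g = 0 -> f = g.
Proof.
move=> fg; apply: profile_ext => w; apply/eqP; rewrite -subr_eq0 -normr_le0.
by have /md_leP[_] : md f g <= 0; rewrite ?fg.
Qed.

Let md_sym f g : md f g = md g f. Proof. by rewrite /md maxC. Qed.

Let md_tri g f h : md f h <= md f g + md g h.
Proof.
have /md_leP[h1 a1] := lexx (md f g); have /md_leP[h2 a2] := lexx (md g h).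
apply/md_leP; split; first exact: addr_ge0.
move=> w; have := a1 w; have := a2 w; rewrite !ler_norml; lra.
Qed.

HB.instance Definition _ := gen_eqMixin profile.
HB.instance Definition _ := gen_choiceMixin profile.
HB.instance Definition _ :=
  isMetric.Build R profile mdxx md_positivity md_sym md_tri.

Let mdE (f g : profile) : mdist f g = md f g. Proof. by []. Qed.

Definition supported := [set u | forall e : R, 0 < e -> (0 < P (B u e))%E].

(* The complement of the support is the union of the null balls among the
   countably many balls with radii 1 / (k + 1) around the points c n. *)
Let measurable_supported_null : measurable supported /\ P (~` supported) = 0%E.
Proof.
pose N := \bigcup_n \bigcup_k
  (if P (B (c n) k.+1%:R^-1) == 0%E then B (c n) k.+1%:R^-1 else set0).
have -> : supported = ~` N.
  apply/seteqP; split=> [u su [n _ [k _]]|u Nu e e0].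
    case: ifP => // /eqP; move: (k.+1%:R^-1) => r P0 uB.
    have e0 : 0 < r - Ds (c n) u by rewrite subr_gt0.
    have := su _ e0; rewrite lt_neqAle => /andP[/eqP + _]; apply.
    apply/esym/eqP; rewrite -measure_le0 -P0; apply: le_measure; rewrite ?inE//.
    - exact: mD.
    - exact: mD.
    by move=> v; rewrite /B/=; have := Ds_tri u (c n) v; lra.
  rewrite lt0e measure_ge0 andbT; apply/eqP => P0; apply: Nu.
  have [k ke] : exists k : nat, k.+1%:R^-1 < e / 2.
    by apply: natSinv_lt; rewrite divr_gt0.
  have k0 : 0 < k.+1%:R^-1 :> R by rewrite invr_gt0.
  have [n un] := cP u k0.
  exists n => //; exists k => //; case: ifPn => [_|/eqP[]].
    by rewrite /B/= DsC.
  apply/eqP; rewrite -measure_le0 -P0; apply: le_measure; rewrite ?inE//.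
  - exact: mD.
  - exact: mD.
  move=> v; rewrite /B/=; have := Ds_tri (c n) u v.
  by move: (k.+1%:R^-1) ke un => r; lra.
have mN : measurable N.
  apply: bigcup_measurable => n _; apply: bigcup_measurable => k _.
  by case: ifP => // _; exact: mD.
split; first exact: measurableC.
rewrite setCK; apply/negligibleP => //.
apply: negligible_bigcup => n; apply: negligible_bigcup => k.
case: ifPn => [/eqP P0|_]; last exact: negligible_set0.
by apply/negligibleP => //; exact: mD.
Qed.

Let measurable_supported : measurable supported.
Proof. by case: measurable_supported_null. Qed.

Let measure_supported A : measurable A -> P (A `&` supported) = P A.
Proof.
move=> mA; have [mS S0] := measurable_supported_null.
rewrite [RHS](measureDI _ mA mS) -[LHS]add0e; congr (_ + _)%E; apply/esym/eqP.
rewrite -measure_le0 -S0; apply: le_measure; rewrite ?inE.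
- exact: measurableD.
- exact: measurableC.
- by move=> u [].
Qed.

Let supported_ex A : measurable A -> (0 < P A)%E -> exists2 u, A u & supported u.
Proof.
move=> mA; rewrite -measure_supported// lt0e => /andP[/eqP PA _].
have /set0P[u [Au su]] : A `&` supported != set0.
  by apply/eqP => A0; apply: PA; rewrite A0 measure0.
by exists u.
Qed.

Let profile_pred_supported u : supported u -> profile_pred (fun n => D (c n) u).
Proof.
by move=> su e e0; exists u; split=> [|w]; [exact: su|rewrite subrr normr0 ltW].
Qed.

Let u0 : {u | supported u}.
Proof.
apply: cid; have [] := @supported_ex setT measurableT _; last by move=> u; exists u.
by rewrite probability_setT.
Qed.

Let base : profile := exist _ _ (profile_pred_supported (svalP u0)).

HB.instance Definition _ := isPointed.Build profile base.

(** Points outside the support form a null set and are sent to an arbitrary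
profile. *)
Definition profile_of u : profile :=
  match pselect (supported u) with
  | left su => exist _ _ (profile_pred_supported su)
  | right _ => base
  end.
Local Notation zeta := profile_of.

Let zetaE u w : supported u -> sval (zeta u) w = D (c w) u.
Proof. by rewrite /zeta; case: pselect. Qed.

Let zeta_base u : ~ supported u -> zeta u = base.
Proof. by rewrite /zeta; case: pselect. Qed.

Let qd_zeta u v : supported u -> supported v -> qd (zeta u) (zeta v) = D u v.
Proof.
move=> su sv; apply/eqP; rewrite eq_le; apply/andP; split.
  apply/qd_leP; split=> // n; rewrite !zetaE//; have := Dtri (c n) u v; lra.
apply/ler_addgt0Pr => e e0.
have [n un] : exists n, Ds u (c n) < e / 2 by apply: cP; rewrite divr_gt0.
have := qdE (zeta u) (zeta v) n; rewrite !zetaE//; have := Dtri u (c n) v.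
by have := D_le u (c n); have := D_le' (c n) u; lra.
Qed.

Let md_zeta u v : supported u -> supported v -> md (zeta u) (zeta v) = Ds u v.
Proof. by move=> su sv; rewrite /md !qd_zeta. Qed.

(* The limit is taken coordinatewise; the Cauchy property makes it uniform. *)
Let profile_complete (F : set_system profile) :
  ProperFilter F -> cauchy F -> cvg F.
Proof.
move=> PF /cauchyP cF.
have cFw w : cvg ((fun f : profile => sval f w) @ F).
  apply/cauchy_cvgP/cauchy_exP => e e0.
  have [f Ff] := cF e e0; exists (sval f w); rewrite /nbhs/=.
  apply: filterS Ff => g; rewrite ballEmdist/= mdE /ball/= => fg.
  apply: le_lt_trans fg; have /md_leP[_] := lexx (md f g); exact.
pose l w := lim ((fun f : profile => sval f w) @ F).
have lP (f : profile) e : 0 < e -> F (ball f e) -> forall w, `|sval f w - l w| <= e.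
  move=> e0 Ff w; apply/ler_addgt0Pr => r r0.
  have /cvgrPdist_le/(_ r r0) h : (fun f : profile => sval f w) @ F --> l w.
    exact: cFw.
  have [g [fg lg]] := filter_ex (filterI Ff h).
  have {lg} : `|l w - sval g w| <= r := lg.
  move: fg; rewrite ballEmdist/= mdE => /ltW/md_leP[_ /(_ w)].
  by rewrite !ler_norml; lra.
have Kl : profile_pred l.
  move=> e e0; have e2 : 0 < e / 2 by rewrite divr_gt0.
  have [f Ff] := cF _ e2; have [u [Pu fu]] := svalP f _ e2.
  exists u; split=> [|w].
    apply: lt_le_trans Pu _; apply: le_measure; rewrite ?inE; [exact: mD..|].
    by move=> v /=; lra.
  have := lP f _ e2 Ff w; have := fu w.
  by rewrite !ler_norml; lra.
apply/cvg_ex; exists (exist _ l Kl : profile).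
apply/metricType_numDomainType.fcvgrPdist_lt => e e0.
have e3 : 0 < e / 3 by rewrite divr_gt0.
have [f Ff] := cF _ e3; have Ff' := Ff; apply: filterS Ff => g fg.
rewrite mdE (@le_lt_trans _ _ (e / 3 + e / 3))//; last by lra.
apply: le_trans (md_tri f _ _) _; apply: lerD.
  apply/md_leP; split; first exact: ltW.
  by move=> w; rewrite distrC /=; exact: (lP f _ e3 Ff').
by move: fg; rewrite ballEmdist/= mdE => /ltW.
Qed.

HB.instance Definition _ := Uniform_isComplete.Build profile profile_complete.

Let M : completeMetricType R := profile.

(* Around every point of the carrier there is a ball of positive measure whose
   supported points have profiles close to it: this gives the density of the
   profiles as well as the full support of their law. *)
Let md_zeta_lt (f : profile) (e : R) : 0 < e ->
  exists u, (0 < P (B u (e / 3)%R))%E /\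
  forall v, supported v -> B u (e / 3) v -> md f (zeta v) < e.
Proof.
move=> e0; have e3 : 0 < e / 3 by rewrite divr_gt0.
have [u [Pu fu]] := svalP f _ e3; exists u; split=> // v sv uv.
apply: (@le_lt_trans _ _ (e / 3 + Ds u v)); last by move: uv; rewrite /B/=; lra.
have Duv : 0 <= Ds u v by apply: le_trans (D_le u v).
apply/md_leP; split=> [|n]; first by lra.
have := fu n; rewrite zetaE// !ler_norml.
have := Dtri (c n) u v; have := Dtri (c n) v u.
by have := D_le u v; have := D_le' v u; lra.
Qed.

(* The points c n need not be supported; whenever a supported point lies within
   1 / (k + 1) of c n, one such point is chosen. *)
Let dense_supported : exists z : nat -> T, (forall i, supported (z i)) /\
  forall (f : M) (e : R), 0 < e -> exists i, mdist f (zeta (z i)) < e.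
Proof.
have /choice[z0 z0P] (nk : nat * nat) : exists v, supported v /\
    forall w, supported w -> Ds (c nk.1) w < nk.2.+1%:R^-1 ->
    Ds (c nk.1) v < nk.2.+1%:R^-1.
  have [[w [sw cw]]|h] := pselect (exists w, supported w /\
      Ds (c nk.1) w < nk.2.+1%:R^-1).
    by exists w; split=> // ? ?.
  exists (sval u0); split; first exact: svalP.
  by move=> w sw cw; exfalso; apply: h; exists w.
have [z [zE z0z]] := enumeration z0 (sval u0).
exists z; split=> [i|f e e0].
  by case: (zE i) => [->|[nk ->]]; [exact: svalP|exact: (z0P nk).1].
have e2 : 0 < e / 2 by rewrite divr_gt0.
have [u [Pu fu]] := md_zeta_lt f e2.
have [v uv sv] := supported_ex (mD u (e / 2 / 3)) Pu.
have [k ke] : exists k : nat, k.+1%:R^-1 < e / 4.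
  by apply: natSinv_lt; rewrite divr_gt0.
have k0 : 0 < k.+1%:R^-1 :> R by rewrite invr_gt0.
have [n vn] := cP v k0; have [sz zP] := z0P (n, k).
have [i ziE] := z0z (n, k); exists i; rewrite ziE mdE.
have := zP v sv; rewrite /= DsC => /(_ vn).
apply: contraPT; rewrite -leNgt => fz /= nz.
have := fu v sv uv; have := md_tri (zeta v) f (zeta (z0 (n, k))).
rewrite md_zeta//; have := Ds_tri (c n) v (z0 (n, k)).
move: (k.+1%:R^-1) ke vn nz => r; lra.
Qed.

Let measurable_zeta : measurable_fun setT (zeta : T -> borel M).
Proof.
have [z [sz dz]] := dense_supported.
apply: (@measurable_to_borel R M _ _ _ (zeta \o z) dz) => n r /=.
rewrite (_ : [set _ | _] =
  (supported `&` [set t | Ds (z n) t < r]) `|`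
  (if md (zeta (z n)) base < r then ~` supported else set0)).
  apply: measurableU; first by apply: measurableI.
  by case: ifP => // _; exact: measurableC.
apply/seteqP; split=> [t /=|t [[st zt]|]].
- have [st|st] := pselect (supported t); rewrite mdE.
    by rewrite md_zeta//; left.
  by rewrite (zeta_base st) => ->; right.
- by rewrite /= mdE md_zeta.
- by case: ifP => [rb st|_ []]; rewrite /= mdE (zeta_base st).
Qed.

Let zeta_mfun : {mfun T >-> borel M} :=
  HB.pack zeta (isMeasurableFun.Build _ _ T (borel M) zeta measurable_zeta).

Let law : probability (borel M) R := distribution P zeta_mfun.

Let separable_M : exists2 E : set M, countable E & dense E.
Proof.
have [z [sz dz]] := dense_supported.
exists (range (zeta \o z)); first by apply: card_le_trans (card_image_le _ _) _.
move=> O [f Of] oO.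
have /metricType_numDomainType.nbhs_mdistP[e /= e0 eO] : nbhs f O.
  by apply: open_nbhs_nbhs; split.
have [i fi] := dz f e e0; exists (zeta (z i)); split; last by exists i.
exact: eO.
Qed.

Let full_support (U : set M) : open U -> U !=set0 -> (0 < law U)%E.
Proof.
move=> oU [f Uf].
have /metricType_numDomainType.nbhs_mdistP[e /= e0 eU] : nbhs f U.
  by apply: open_nbhs_nbhs; split.
have [u [Pu fu]] := md_zeta_lt f e0; apply: lt_le_trans Pu _.
rewrite -measure_supported; last exact: mD.
change (P (B u (e / 3)%R `&` supported) <= P (zeta @^-1` U))%E.
apply: le_measure; rewrite ?inE.
- by apply: measurableI => //; exact: mD.
- rewrite -[X in measurable X]setTI; apply: (measurable_zeta measurableT).
  exact: sub_sigma_algebra.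
- by move=> v [uv sv]; apply: eU; exact: fu.
Qed.

Definition realization : qmSpace R :=
  @QMSpace R M qd qd0 qdxx (fun f g h => qd_tri f g h) (fun f g => erefl)
    separable_M law full_support.

Lemma realizationP : exists (Z : qmSpace R) (f : T -> Z) (S : set T),
  [/\ measurable_fun setT (f : T -> borel Z),
      forall A : set (borel Z), measurable A -> P (f @^-1` A) = qm_measure Z A,
      measurable S, P (~` S) = 0%E &
      forall u v, S u -> S v -> qdist (f u) (f v) = D u v].
Proof.
exists realization, zeta, supported; split => //.
- by have [] := measurable_supported_null.
Qed.

End realization.

(** * Markov chains of labels *)

Section joint_labels.
Variable R : realType.

Lemma measurable_label2 d (T : measurableType d) (a b : T -> nat)
    (J : nat -> nat -> Prop) :
  measurable_fun setT a -> measurable_fun setT b ->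
  measurable [set t | J (a t) (b t)].
Proof.
move=> ma mb.
rewrite (_ : [set _ | _] = \bigcup_i \bigcup_j
   (if `[< J i j >] then a @^-1` [set i] `&` b @^-1` [set j] else set0)).
  apply: bigcup_measurable => i _; apply: bigcup_measurable => j _.
  by case: ifP => // _; apply: measurableI; exact: measurable_label.
apply/seteqP; split=> [t /= Jt|t [i _ [j _]]].
  by exists (a t) => //; exists (b t) => //; rewrite asboolT.
by case: asboolP => // Jij [/= -> ->].
Qed.

Lemma measure_label2 d (T : measurableType d) (P : {measure set T -> \bar R})
    (a b : T -> nat) (n m : nat) (J : nat -> nat -> Prop) :
  measurable_fun setT a -> measurable_fun setT b ->
  (forall t, (a t < n)%N) -> (forall t, (b t < m)%N) ->
  P [set t | J (a t) (b t)] = (\sum_(i < n) \sum_(j < m)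
    if `[< J i j >] then P [set t | a t = i /\ b t = j] else 0)%E.
Proof.
move=> ma mb an bm.
rewrite (measure_label_sum P ma an (measurable_label2 _ ma mb)).
apply: eq_bigr => i _; rewrite (measure_label_sum P mb bm); last first.
  by apply: measurableI; [exact: measurable_label2|exact: measurable_label].
apply: eq_bigr => j _; case: asboolP => Jij.
  congr (P _); apply/seteqP; split=> t; first by move=> [[_ ?] ?].
  by move=> [/= ai bj]; rewrite ai bj.
rewrite (_ : _ `&` _ = set0) ?measure0//.
by apply/seteqP; split=> // t [[/= + ai] bj]; rewrite ai bj.
Qed.

Lemma measurable_fst_borel (X Z : qmSpace R) :
  measurable_fun setT (fst : borel (X * Z)%type -> borel X).
Proof.
by apply: preimage_g_sigma => B oB; apply: open_comp => // -[x z] _; exact: cvg_fst.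
Qed.

Lemma measurable_snd_borel (X Z : qmSpace R) :
  measurable_fun setT (snd : borel (X * Z)%type -> borel Z).
Proof.
by apply: preimage_g_sigma => B oB; apply: open_comp => // -[x z] _; exact: cvg_snd.
Qed.

Lemma family_choice (I : Type) (A : I -> Type) (Q : forall k, A k -> Prop) :
  (forall k, exists x, Q k x) -> exists f : forall k, A k, forall k, Q k (f k).
Proof. by move=> h; exists (fun k => sval (cid (h k))) => k; case: cid. Qed.

Lemma staged_choice (A : Type) (Q : nat -> A -> Prop)
    (S : nat -> A -> A -> Prop) :
  (exists x, Q 0%N x) ->
  (forall k x, Q k x -> exists y, Q k.+1 y /\ S k x y) ->
  exists f : nat -> A, forall k, Q k (f k) /\ S k (f k) (f k.+1).
Proof.
move=> [x0 Qx0] step.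
pose stage := {kx : nat * A | Q kx.1 kx.2}.
pose next (z w : stage) := (sval w).1 = (sval z).1.+1 /\
  S (sval z).1 (sval z).2 (sval w).2.
have nextP z : {w | next z w}.
  apply: cid; have [y [Qy Sxy]] := step _ _ (svalP z).
  by exists (exist _ ((sval z).1.+1, y) Qy).
have [f [f0 fS]] := dependent_choice nextP (exist _ (0%N, x0) Qx0 : stage).
have f1 k : (sval (f k)).1 = k by elim: k => [|k IHk]; rewrite ?f0// (fS k).1 IHk.
exists (fun k => (sval (f k)).2) => k; split.
  by have := svalP (f k); rewrite f1.
by have [_] := fS k; rewrite f1.
Qed.

End joint_labels.

Section label_chain.
Local Unset Implicit Arguments.
Variables (R : realType) (d : measure_display) (T : measurableType d)
  (P : probability T R).
Hypothesis divP : divisible P.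
Variables (Y : nat -> qmSpace R) (n : nat -> nat) (a : forall k, Y k -> nat)
  (pi : forall k, probability (borel (Y k * Y k.+1)%type) R).
Hypotheses (ma : forall k, measurable_fun setT (a k : borel (Y k) -> nat))
  (an : forall k x, (a k x <= n k)%N) (cpi : forall k, coupling (pi k)).


Let a1 k (p : Y k * Y k.+1) := a k p.1.
Let a2 k (p : Y k * Y k.+1) := a k.+1 p.2.

Let ma1 k : measurable_fun setT (a1 k : borel (Y k * Y k.+1)%type -> nat).
Proof. exact: (measurableT_comp (ma k) (@measurable_fst_borel _ _ _)). Qed.

Let ma2 k : measurable_fun setT (a2 k : borel (Y k * Y k.+1)%type -> nat).
Proof. exact: (measurableT_comp (ma k.+1) (@measurable_snd_borel _ _ _)). Qed.

Let joint k i j := [set p | a1 k p = i /\ a2 k p = j].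

Let p k i j := fine (pi k (joint k i j)).

Let pE k i j : pi k (joint k i j) = (p k i j)%:E.
Proof.
rewrite /p fineK// fin_num_measure//.
exact: (measurable_label2 (fun x y => x = i /\ y = j) (ma1 k) (ma2 k)).
Qed.

Let p0 k i j : 0 <= p k i j. Proof. by rewrite fine_ge0. Qed.

Let row k i : qm_measure (Y k) (a k @^-1` [set i]) =
  (\sum_(j < (n k.+1).+1) p k i j)%:E.
Proof.
have [c1 _] := cpi k; rewrite -c1; last exact: measurable_label.
rewrite (@measure_label_sum R _ _ (pi k) (a2 k) (n k.+1).+1 _ (ma2 k)).
- by rewrite -sumEFin; apply: eq_bigr => j _; rewrite -pE.
- by move=> t; rewrite ltnS; exact: an.
- exact: (measurable_label _ (ma1 k)).
Qed.

Let column k j : qm_measure (Y k.+1) (a k.+1 @^-1` [set j]) =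
  (\sum_(i < (n k).+1) p k i j)%:E.
Proof.
have [_ c2] := cpi k; rewrite -c2; last exact: measurable_label.
rewrite (@measure_label_sum R _ _ (pi k) (a1 k) (n k).+1 _ (ma1 k)).
- rewrite -sumEFin; apply: eq_bigr => i _; rewrite -pE.
  by congr (pi k _); apply/seteqP; split=> q [].
- by move=> t; rewrite ltnS; exact: an.
- exact: (measurable_label _ (ma2 k)).
Qed.

Let has_law k (phi : T -> nat) :=
  [/\ measurable_fun setT phi, forall t, (phi t <= n k)%N &
  forall i, (i <= n k)%N ->
    P (phi @^-1` [set i]) = qm_measure (Y k) (a k @^-1` [set i])].

(** The labels of each Y k serve as states of a Markov chain whose transitions
are read off the couplings. The agreement of the joint laws of consecutive
labels transfers every event on such pairs from the couplings to T. *)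
Lemma label_chain : exists phi : nat -> T -> nat, forall k,
  has_law k (phi k) /\
  forall J : nat -> nat -> Prop,
    P [set t | J (phi k t) (phi k.+1 t)] =
    pi k [set p | J (a k p.1) (a k.+1 p.2)].
Proof.
have [phi phiP] : exists phi : nat -> T -> nat, forall k, has_law k (phi k) /\
    forall i j, (i <= n k)%N -> (j <= n k.+1)%N ->
    P [set t | phi k t = i /\ phi k.+1 t = j] = (p k i j)%:E.
  apply: (@staged_choice _ has_law (fun k f g => forall i j,
    (i <= n k)%N -> (j <= n k.+1)%N ->
    P [set t | f t = i /\ g t = j] = (p k i j)%:E)).
    pose q i := fine (qm_measure (Y 0%N) (a 0%N @^-1` [set i])).
    have qE i : qm_measure (Y 0%N) (a 0%N @^-1` [set i]) = (q i)%:E.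
      by rewrite fineK// fin_num_measure//; exact: measurable_label.
    have [||psi [mpsi psin psiP]] := @divisible_split R _ T P (n 0%N) setT q
      divP measurableT.
    - by move=> i; exact: fine_ge0.
    - rewrite probability_setT -(probability_setT (qm_measure (Y 0%N))).
      rewrite (@measure_label_sum R _ _ _ _ (n 0%N).+1 _ (ma 0%N))//.
        by rewrite -sumEFin; apply: eq_bigr => i _; rewrite setTI; exact: qE.
      by move=> t; rewrite ltnS; exact: an.
    exists psi; split=> // i iln; rewrite qE -psiP//.
    by rewrite setTI.
  move=> k f [mf fn fP].
  have [|psi [mpsi psin psiP]] := divisible_joint (m := n k.+1) divP mf fn (p0 k).
    by move=> i iln; rewrite fP// row.
  exists psi; split; last exact: psiP.
  split=> // j jn; rewrite column.
  rewrite (@measure_label_sum R _ _ P f (n k).+1 _ mf)//.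
    by rewrite -sumEFin; apply: eq_bigr => i _; rewrite -psiP// -1?ltnS//;
      congr (P _); apply/seteqP; split=> t [].
  exact: measurable_label.
exists phi => k; have [hk joint_k] := phiP k; split => // J.
have [mf fn _] := hk; have [[mg gn _] _] := phiP k.+1.
rewrite (@measure_label2 _ _ _ P _ _ (n k).+1 (n k.+1).+1)//.
rewrite (@measure_label2 _ _ _ (pi k) (a1 k) (a2 k) (n k).+1 (n k.+1).+1 J (ma1 k) (ma2 k)).
- apply: eq_bigr => i _; apply: eq_bigr => j _; case: ifP => // _.
  exact: (etrans (joint_k i j (ltn_ord i) (ltn_ord j)) (esym (pE k i j))).
- by move=> t; rewrite ltnS; exact: an.
- by move=> t; rewrite ltnS; exact: an.
Qed.

End label_chain.
Arguments label_chain {R d T P} divP {Y n a pi} ma an cpi.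

(** * Passage to the limit along the chain *)

Section borel_cantelli.
Variable R : realType.

Definition half_pow (k : nat) : R := 2^-1 ^+ k.

Lemma half_pow_gt0 k : 0 < half_pow k.
Proof. by rewrite exprn_gt0// invr_gt0. Qed.

Lemma half_powS k : half_pow k = 2 * half_pow k.+1.
Proof. by rewrite /half_pow exprS mulrA divff// mul1r. Qed.

Lemma half_pow_lt (e : R) : 0 < e -> exists N, forall k, (N <= k)%N -> half_pow k < e.
Proof.
move=> e0; have /cvgrPdist_lt/(_ e e0)[N _ NP] : half_pow @ \oo --> (0 : R).
  by apply: cvg_expr; rewrite ger0_norm ?invr_ge0// invf_lt1// ltr1n.
exists N => k Nk; have := NP k Nk; rewrite /= sub0r normrN ger0_norm//.
exact/ltW/half_pow_gt0.
Qed.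

Lemma measure_bigcup_half_pow d (T : measurableType d) (P : probability T R)
    (F : nat -> set T) (c : R) (k : nat) : 0 <= c ->
  (forall l, measurable (F l)) ->
  (forall l, (P (F l) <= (c * half_pow l)%:E)%E) ->
  (P (\bigcup_(l in [set l | (k <= l)%N]) F l) <= (2 * c * half_pow k)%:E)%E.
Proof.
move=> c0 mF PF.
have -> : \bigcup_(l in [set l | (k <= l)%N]) F l = \bigcup_l F (k + l)%N.
  apply/seteqP; split=> [t [l /= kl Ft]|t [l _ Ft]].
    by exists (l - k)%N => //; rewrite subnKC.
  by exists (k + l)%N => //=; rewrite leq_addr.
apply: (le_trans (measure_sigma_subadditive _ (fun l => mF (k + l)%N) _ (@subset_refl _ _))).
  exact: bigcup_measurable.
apply: lime_le; first by apply: is_cvg_nneseries.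
apply: nearW => m; apply: (@le_trans _ _ (\sum_(0 <= l < m) (c * half_pow (k + l))%:E)%E).
  by apply: lee_sum => l _; exact: PF.
rewrite sumEFin lee_fin.
suff -> : \sum_(0 <= l < m) c * half_pow (k + l) =
    2 * c * half_pow k - 2 * c * half_pow (k + m).
  by rewrite gerBl// !mulr_ge0//; exact/ltW/half_pow_gt0.
elim: m => [|m IHm]; first by rewrite big_nil addn0 subrr.
rewrite big_nat_recr//= IHm addnS [half_pow (k + m)]half_powS; lra.
Qed.

(** Borel-Cantelli: almost every point lies in E l for all large l. The map r
moves the exceptional null set to a single good point, which makes the property
hold everywhere without changing the law. *)
Lemma eventually_good d (T : measurableType d) (P : probability T R)
    (E : nat -> set T) (c : R) : 0 <= c -> (forall k, measurable (E k)) ->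
  (forall k, (P (~` E k) <= (c * half_pow k)%:E)%E) ->
  exists r : T -> T, [/\ measurable_fun setT r,
    forall A, measurable A -> P (r @^-1` A) = P A,
    forall t, exists k, forall l, (k <= l)%N -> E l (r t) &
    forall k, (P (~` [set t | forall l, (k <= l)%N -> E l (r t)])
      <= (2 * c * half_pow k)%:E)%E].
Proof.
move=> c0 mE PE.
pose A k := \bigcap_(l in [set l | (k <= l)%N]) E l.
have mA k : measurable (A k) by apply: bigcap_measurableType => l _.
have PA k : (P (~` A k) <= (2 * c * half_pow k)%:E)%E.
  rewrite setC_bigcap; apply: measure_bigcup_half_pow => // l.
  exact: measurableC.
pose A0 := \bigcup_k A k.
have mA0 : measurable A0 by exact: bigcupT_measurable.
have PA0 : P (~` A0) = 0%E.
  apply/eqP; rewrite -measure_le0; apply/lee_addgt0Pr => e e0.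
  rewrite add0e; have ec : 0 < e / (2 * c + 1) by rewrite divr_gt0//; lra.
  have [N /(_ N (leqnn N)) hN] := half_pow_lt ec.
  apply: (@le_trans _ _ (P (~` A N))).
    apply: le_measure; rewrite ?inE; [exact: measurableC..|].
    by move=> t nA At; apply: nA; exists N.
  apply: (le_trans (PA N)); rewrite lee_fin.
  have h0 := half_pow_gt0 N; move: hN; rewrite ltr_pdivlMr; last by lra.
  by lra.
have [t0 [k0 _ At0]] : A0 !=set0.
  apply/set0P/eqP => A00; move: PA0.
  by rewrite A00 setC0 probability_setT => /eqP; rewrite onee_eq0.
pose r t := if t \in A0 then t else t0.
have rA t : A0 t -> r t = t by rewrite /r => /mem_set ->.
have rE (B : set T) : r @^-1` B =
    (A0 `&` B) `|` (if `[< B t0 >] then ~` A0 else set0).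
  apply/seteqP; split=> t /=; rewrite /r.
    case: ifPn => [/set_mem At Bt|/negP At Bt]; first by left.
    by right; rewrite asboolT// => /mem_set.
  move=> [[/mem_set -> //]|]; case: asboolP => // Bt.
  by case: ifPn => // /set_mem At /(_ At).
exists r; split.
- move=> _ B mB; rewrite setTI rE; apply: measurableU; first exact: measurableI.
  by case: ifP => // _; exact: measurableC.
- move=> B mB; rewrite rE.
  have mIB : measurable (A0 `&` B) by exact: measurableI.
  rewrite (measureU0 mIB); first last.
  + by case: ifP => // _; exact: measure0.
  + by case: ifP => // _; exact: measurableC.
  rewrite [RHS](measureDI _ mB mA0) [X in (X + _)%E](_ : _ = 0%E) ?add0e 1?setIC//.
  apply/eqP; rewrite -measure_le0 -PA0; apply: le_measure; rewrite ?inE.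
  + exact: measurableD.
  + exact: measurableC.
  + by move=> t [].
- move=> t; rewrite /r; case: ifPn => [/set_mem[k _ At]|_].
    by exists k => l kl; exact: At.
  by exists k0 => l kl; exact: At0.
- move=> k; apply: le_trans (PA k); apply: le_measure; rewrite ?inE.
  + apply: measurableC.
    rewrite (_ : [set _ | _] = r @^-1` A k).
      rewrite rE; apply: measurableU; first exact: measurableI.
      by case: ifP => // _; exact: measurableC.
    by apply/seteqP; split=> t /= h l; exact: h.
  + exact: measurableC.
  + move=> t /= nE At; apply: nE => l kl; rewrite rA; first exact: At.
    by exists k.
Qed.

End borel_cantelli.

Section limit_realization.
Variables (R : realType) (d : measure_display) (T : measurableType d)
  (P : probability T R).

(** Over A k, the quasi-distances between the labelled points form a Cauchy
sequence from the index k on; the constant 8 is the sum of the series of the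
increments 4 * 2^-l divided by 2^-k. The limit is separable because two points of
A k with the same k-th label are close. *)
Lemma limit_realization (Y : nat -> qmSpace R) (y : forall k, nat -> Y k)
    (phi : nat -> T -> nat) (A : nat -> set T) :
  (forall k, measurable_fun setT (phi k)) ->
  (forall k l, (k <= l)%N -> A k `<=` A l) ->
  (forall t, exists k, A k t) ->
  (forall k s t, A k s -> A k t ->
    `|qdist (y k (phi k s)) (y k (phi k t)) -
      qdist (y k.+1 (phi k.+1 s)) (y k.+1 (phi k.+1 t))| <= 4 * half_pow R k) ->
  exists (Z : qmSpace R) (f : T -> Z) (S : set T),
  [/\ measurable_fun setT (f : T -> borel Z),
      forall B : set (borel Z), measurable B -> P (f @^-1` B) = qm_measure Z B,
      measurable S, P (~` S) = 0%E &
      forall k s t, A k s -> A k t -> S s -> S t ->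
      `|qdist (y k (phi k s)) (y k (phi k t)) - qdist (f s) (f t)|
        <= 8 * half_pow R k].
Proof.
move=> mphi ndA covA step.
pose e := half_pow R.
have e0 k : 0 < e k by exact: half_pow_gt0.
pose D k s t := qdist (y k (phi k s)) (y k (phi k t)).
have tele k m s t : A k s -> A k t ->
    `|D k s t - D (k + m)%N s t| <= 8 * e k - 8 * e (k + m)%N.
  move=> As At; elim: m => [|m]; first by rewrite addn0 !subrr normr0.
  have := step (k + m)%N s t (ndA _ _ (leq_addr _ _) _ As)
    (ndA _ _ (leq_addr _ _) _ At).
  rewrite -/(D (k + m)%N s t) -/(D (k + m).+1 s t) addnS.
  by rewrite [e (k + m)%N]half_powS half_powS -/(e _) !ler_norml; lra.
have near k l s t : (k <= l)%N -> A k s -> A k t ->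
    `|D k s t - D l s t| <= 8 * e k.
  move=> kl As At; have := tele k (l - k)%N s t As At; rewrite subnKC// => h.
  by apply: le_trans h _; have := e0 l; lra.
have common s t u r : 0 < r ->
    exists k, [/\ A k s, A k t, A k u & 8 * e k < r].
  move=> r0; have [k1 h1] := covA s; have [k2 h2] := covA t.
  have [k3 h3] := covA u; have r8 : 0 < r / 8 by rewrite divr_gt0.
  have [N hN] := half_pow_lt r8; exists (k1 + k2 + k3 + N)%N.
  have := hN (k1 + k2 + k3 + N)%N (leq_addl _ _); rewrite -/(e _) => hk.
  split; [apply: ndA h1|apply: ndA h2|apply: ndA h3|lra].
  - by rewrite -!addnA leq_addr.
  - by rewrite -addnA addnAC leq_addl.
  - by rewrite addnAC leq_addl.
have cD s t : cvg ((fun k => D k s t) @ \oo).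
  apply/cauchy_cvgP/cauchy_exP => r r0.
  have [k [As At _ kr]] := common s t t r r0.
  exists (D k s t); exists k => // l /= kl; rewrite /ball/=.
  exact: le_lt_trans (near k l s t kl As At) kr.
pose Dl s t := lim ((fun k => D k s t) @ \oo).
have DlP k s t : A k s -> A k t -> `|D k s t - Dl s t| <= 8 * e k.
  move=> As At; apply/ler_addgt0Pr => r r0.
  have /cvgrPdist_le/(_ r r0)[N _ NP] : (fun k => D k s t) @ \oo --> Dl s t by exact: cD.
  have {NP} : `|Dl s t - D (k + N)%N s t| <= r by apply: NP; rewrite /= leq_addl.
  have := near k (k + N)%N s t (leq_addr _ _) As At.
  by rewrite !ler_norml; lra.
have Dl0 s t : 0 <= Dl s t.
  apply/ler_addgt0Pr => r r0; have [k [As At _ kr]] := common s t t r r0.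
  have := DlP k s t As At; have : 0 <= D k s t by exact: qdist_ge0.
  by rewrite ler_norml; lra.
have Dltri s t u : Dl s u <= Dl s t + Dl t u.
  apply/ler_addgt0Pr => r r0; have r3 : 0 < r / 3 by rewrite divr_gt0.
  have [k [As At Au kr]] := common s t u _ r3.
  have := DlP k s t As At; have := DlP k t u At Au; have := DlP k s u As Au.
  have : D k s u <= D k s t + D k t u by exact: qdist_triangle.
  by rewrite !ler_norml; lra.
have mDl u : measurable_fun setT (Dl u) /\ measurable_fun setT (Dl ^~ u).
  split; apply: (@measurable_fun_cvg _ _ _ setT).
  - by move=> k; apply: (measurableT_comp (f := fun i => qdist (y k (phi k u)) (y k i)) _ (mphi k)).
  - by move=> t _; exact: cD.
  - by move=> k; apply: (measurableT_comp (f := fun i => qdist (y k i) (y k (phi k u))) _ (mphi k)).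
  - by move=> t _; exact: cD.
have mball u r : measurable [set v | sym_dist Dl u v < r].
  have [m1 m2] := mDl u.
  have mm : measurable_fun setT (fun v => Num.max (Dl u v) (Dl v u)).
    exact: measurable_maxr.
  rewrite -[X in measurable X]setTI.
  by apply: (mm measurableT `]-oo, r[%classic); exact: measurable_itv.
have [c cP] : exists c : nat -> T, forall u (r : R), 0 < r ->
    exists n, sym_dist Dl u (c n) < r.
  have /choice[c0 c0P] (ki : nat * nat) : exists t, forall s, A ki.1 s ->
      phi ki.1 s = ki.2 -> A ki.1 t /\ phi ki.1 t = ki.2.
    have [[s [As ps]]|h] := pselect (exists s, A ki.1 s /\ phi ki.1 s = ki.2).
      by exists s.
    by exists point => s As ps; exfalso; apply: h; exists s.
  have [c [_ c0c]] := enumeration c0 point.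
  exists c => u r r0; have [k [Au _ _ kr]] := common u u u r r0.
  have [n cn] := c0c (k, phi k u); exists n.
  have [/= Ac pc] := c0P (k, phi k u) u Au erefl.
  rewrite cn /sym_dist gt_max; move: Ac pc; set t := c0 _ => At pt.
  have := DlP k u t Au At; have := DlP k t u At Au.
  have -> : D k u t = 0 by rewrite /D pt qdistxx.
  have -> : D k t u = 0 by rewrite /D pt qdistxx.
  by rewrite !ler_norml; lra.
have [Z [f [S [mf Pf mS PS fD]]]] := realizationP P Dl0 Dltri mball cP.
exists Z, f, S; split => // k s t As At Ss St.
by rewrite fD//; exact: DlP.
Qed.

End limit_realization.

(** * Completeness *)

Section completeness.
Variable R : realType.
Local Notation e := (half_pow R).

Lemma measureU3_le d (T : measurableType d) (P : {measure set T -> \bar R})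
    (A B C : set T) (a b c : R) :
  measurable A -> measurable B -> measurable C ->
  (P A <= a%:E)%E -> (P B <= b%:E)%E -> (P C <= c%:E)%E ->
  (P (A `|` B `|` C) <= (a + b + c)%:E)%E.
Proof.
move=> mA mB mC PA PB PC; rewrite 2!EFinD.
apply: le_trans (measureU2 _ (measurableU _ _ mA mB) mC) _.
apply: leeD => //; apply: le_trans (measureU2 _ mA mB) _.
exact: leeD.
Qed.

(** If both label laws give almost the same mass to each label, then the labels
can be coupled so that they mostly agree: the common part of the two laws is
put on the diagonal, and the two remainders are coupled independently. *)
Lemma near_label_gluing d1 d2 (T1 : measurableType d1) (T2 : measurableType d2)
    (P1 : probability T1 R) (P2 : probability T2 R) (a : T1 -> nat)
    (b : T2 -> nat) (n : nat) (eta : R) :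
  measurable_fun setT a -> measurable_fun setT b ->
  (forall t, (a t <= n)%N) -> (forall t, (b t <= n)%N) ->
  (forall i, (i <= n)%N ->
    `|fine (P1 (a @^-1` [set i])) - fine (P2 (b @^-1` [set i]))| <= eta) ->
  exists Q : probability (T1 * T2)%type R,
  [/\ forall A, measurable A -> Q (fst @^-1` A) = P1 A,
      forall A, measurable A -> Q (snd @^-1` A) = P2 A &
      (Q [set t | a t.1 <> b t.2] <= (n.+1%:R * eta)%:E)%E].
Proof.
move=> ma mb an bn near.
pose m i := fine (P1 (a @^-1` [set i])).
pose m' i := fine (P2 (b @^-1` [set i])).
have mE i : P1 (a @^-1` [set i]) = (m i)%:E.
  by rewrite fineK// fin_num_measure//; exact: measurable_label.
have m'E i : P2 (b @^-1` [set i]) = (m' i)%:E.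
  by rewrite fineK// fin_num_measure//; exact: measurable_label.
have sum_m : \sum_(i < n.+1) m i = 1.
  apply: EFin_inj; rewrite -(probability_setT P1).
  rewrite (@measure_label_sum _ _ _ P1 a n.+1 _ ma an)// -sumEFin.
  by apply: eq_bigr => i _; rewrite setTI; exact/esym/mE.
have sum_m' : \sum_(i < n.+1) m' i = 1.
  apply: EFin_inj; rewrite -(probability_setT P2).
  rewrite (@measure_label_sum _ _ _ P2 b n.+1 _ mb bn)// -sumEFin.
  by apply: eq_bigr => i _; rewrite setTI; exact/esym/m'E.
(* mu is the common part of the two laws, al and be are the remainders, and r is
   the mass of each remainder. *)
pose mu i := Num.min (m i) (m' i).
pose al i := m i - mu i.
pose be i := m' i - mu i.
have al0 i : 0 <= al i by rewrite subr_ge0 ge_min lexx.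
have be0 i : 0 <= be i by rewrite subr_ge0 ge_min lexx orbT.
have mu0 i : 0 <= mu i by rewrite le_min /m /m' !fine_ge0.
pose r := \sum_(i < n.+1) al i.
have r0 : 0 <= r by exact: sumr_ge0.
have rE : r = \sum_(i < n.+1) be i.
  by rewrite /r /al /be !sumrB sum_m sum_m'.
have al_r i : (i < n.+1)%N -> al i * r / r = al i.
  move=> ilt; have [rr|rr] := eqVneq r 0; last by rewrite mulfK.
  have : al i <= r by rewrite /r (bigD1 (Ordinal ilt))//= lerDl sumr_ge0.
  by rewrite rr mulr0 mul0r; have := al0 i; lra.
have be_r i : (i < n.+1)%N -> be i * r / r = be i.
  move=> ilt; have [rr|rr] := eqVneq r 0; last by rewrite mulfK.
  have : be i <= r by rewrite rE (bigD1 (Ordinal ilt))//= lerDl sumr_ge0.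
  by rewrite rr mulr0 mul0r; have := be0 i; lra.
pose p (i j : nat) := (if i == j then mu i else 0) + al i * be j / r.
have ab0 i j : 0 <= al i * be j / r by rewrite divr_ge0// mulr_ge0.
have p0 i j : 0 <= p i j by rewrite addr_ge0//; case: ifP.
have row i : (i < n.+1)%N -> \sum_(j < n.+1) p i j = m i.
  move=> ilt; rewrite big_split/= -mulr_suml -mulr_sumr -rE al_r//.
  rewrite (bigD1 (Ordinal ilt))//= big1 ?addr0 ?eqxx; first by rewrite /al; lra.
  by move=> j ji; case: eqP => // ij; move/eqP : ji => []; exact/ord_inj.
have column j : (j < n.+1)%N -> \sum_(i < n.+1) p i j = m' j.
  move=> jlt; rewrite big_split/= -mulr_suml -mulr_suml -/r [r * _]mulrC be_r//.
  rewrite (bigD1 (Ordinal jlt))//= big1 ?addr0 ?eqxx; first by rewrite /be; lra.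
  by move=> i ji; case: eqP => // ij; move/eqP : ji => []; exact/ord_inj.
have [||Q [Q1 Q2 Qp]] := @gluing _ _ _ _ _ P1 P2 a b n.+1 p ma mb an bn p0; last 1 first.
- exists Q; split => //.
  have ma1 : measurable_fun setT (a \o fst : T1 * T2 -> nat).
    exact: measurableT_comp.
  have mb2 : measurable_fun setT (b \o snd : T1 * T2 -> nat).
    exact: measurableT_comp.
  rewrite (@measure_label2 _ _ _ Q (a \o fst) (b \o snd) n.+1 n.+1
    (fun i j => i <> j) ma1 mb2 (fun t => an t.1) (fun t => bn t.2)).
  have -> : (n.+1%:R * eta)%:E = (\sum_(i < n.+1) eta%:E)%E.
    by rewrite sumEFin sumr_const card_ord mulr_natl.
  apply: lee_sum => i _.
  rewrite (eq_bigr (fun j : 'I_n.+1 => (if i != j then p i j else 0)%:E)); last first.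
    move=> j _; case: asboolP => ij; case: eqP => ij' //.
      by exfalso; apply: ij; rewrite ij'.
    by exact: Qp.
    by exfalso; apply: ij => /ord_inj.
  rewrite sumEFin lee_fin -big_mkcond/=.
  have := row i (ltn_ord i); rewrite (bigD1 i)//=.
  rewrite (eq_bigl (fun j => i != j)); last by move=> j; rewrite eq_sym.
  have : mu i <= p i i by rewrite /p eqxx lerDl.
  have := near i (ltn_ord i); rewrite -/(m i) -/(m' i).
  move: (\sum_(j < _ | _) _) => x; rewrite /mu ler_norml minEle.
  by case: ifP => _; lra.
- by move=> i ilt; rewrite mE row.
- by move=> j jlt; rewrite m'E column.
Qed.

(** The bound holds for every X close to Y k, so it applies to all the late
terms of a Cauchy sequence from which Y is extracted. The constant 11 is
1 + 2 + 8, for the passages from X to Y k, from Y k to its labelled points, and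
from these to the limit. *)
Lemma chain_limit (Y : nat -> qmSpace R) :
  (forall k, (box (Y k) (Y k.+1) < (e k)%:E)%E) ->
  exists Z : qmSpace R, forall k X, (box X (Y k) < (e k)%:E)%E ->
    (box X Z <= (11 * e k)%:E)%E.
Proof.
move=> hY; have e0 k : 0 < e k by exact: half_pow_gt0.
have /family_choice[pi /family_choice[S SP]] := fun k => box_lt_coupling (hY k).
have /family_choice[n /family_choice[y /family_choice[a /family_choice[G GP]]]] :=
  fun k => labelling (Y k) (e0 k).
pose T := measurableTypeR R.
pose P : probability T R := @unit_lebesgue R.
have ma k : measurable_fun setT (a k : borel (Y k) -> nat) by have [] := GP k.
have an k x : (a k x <= n k)%N by have [_ +] := GP k; exact.
have mG k : measurable (G k) by have [] := GP k.
have PG k : (qm_measure (Y k) (~` G k) < (e k)%:E)%E by have [] := GP k.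
have GyP k x : G k x -> mdist x (y k (a k x)) < e k by have [_ _ _ _] := GP k; exact.
have cpi k : coupling (pi k) by have [] := SP k.
have cS k : closed (S k) by have [] := SP k.
have PS k : (pi k (~` S k) < (e k)%:E)%E by have [] := SP k.
have dS k : distortion_le (S k) (e k) by have [] := SP k.
have [phi phiP] := label_chain (@divisible_unit_lebesgue R) ma an cpi.
have mphi k : measurable_fun setT (phi k : T -> nat) by have [[]] := phiP k.
have phin k t : (phi k t <= n k)%N by have [[_ +]] := phiP k; exact.
(* The labels i and j are compatible if they are carried by two good points that
   are matched by the coupling of Y k and Y k.+1. *)
pose J k i j := exists x x',
  [/\ S k (x, x'), G k x, G k.+1 x', a k x = i & a k.+1 x' = j].
pose E k : set T := [set t | J k (phi k t) (phi k.+1 t)].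
have mE k : measurable (E k) by exact: measurable_label2.
have PE k : (P (~` E k) <= (3 * e k)%:E)%E.
  have [_ /(_ (fun i j => ~ J k i j)) h] := phiP k.
  rewrite [X in (X <= _)%E]h.
  pose B1 := fst @^-1` (~` G k) : set (borel (Y k * Y k.+1)%type).
  pose B2 := snd @^-1` (~` G k.+1) : set (borel (Y k * Y k.+1)%type).
  have mB1 : measurable B1.
    rewrite -[B1]setTI; apply: (@measurable_fst_borel R (Y k) (Y k.+1)) => //.
    exact: measurableC.
  have mB2 : measurable B2.
    rewrite -[B2]setTI; apply: (@measurable_snd_borel R (Y k) (Y k.+1)) => //.
    exact: measurableC.
  have mS : measurable (~` S k : set (borel (Y k * Y k.+1)%type)).
    by apply: measurableC; exact: closed_measurable.
  apply: (@le_trans _ _ (pi k (~` S k `|` B1 `|` B2))).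
    apply: le_measure; rewrite ?inE.
    - apply: (measurable_label2 (fun i j => ~ J k i j)).
      + exact: (measurableT_comp (ma k) (@measurable_fst_borel _ _ _)).
      + exact: (measurableT_comp (ma k.+1) (@measurable_snd_borel _ _ _)).
    - by apply: measurableU => //; exact: measurableU.
    - move=> [x x'] /= nJ; apply: contrapT => /not_orP[/not_orP[s g] g'].
      by apply: nJ; exists x, x'; split => //; apply: contrapT.
  have [c1 c2] := cpi k.
  have eS : e k.+1 <= e k by rewrite [leRHS]half_powS; have := e0 k.+1; lra.
  apply: (@le_trans _ _ (e k + e k + e k.+1)%:E); last by rewrite lee_fin; lra.
  apply: measureU3_le => //; first exact/ltW/PS.
    rewrite [X in (X <= _)%E](c1 (~` G k)); last exact: measurableC.
    exact/ltW/PG.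
  rewrite [X in (X <= _)%E](c2 (~` G k.+1)); last exact: measurableC.
  exact/ltW/PG.
have [r [mr Pr covr PAr]] := eventually_good (ler0n _ 3) mE PE.
pose A k : set T := [set t | forall l, (k <= l)%N -> E l (r t)].
pose psi k t := phi k (r t).
have mpsi k : measurable_fun setT (psi k) by exact: measurableT_comp.
have mA k : measurable (A k).
  rewrite (_ : A k = \bigcap_(l in [set l | (k <= l)%N]) (r @^-1` E l)).
    apply: bigcap_measurableType => l _; rewrite -[X in measurable X]setTI.
    exact: mr.
  by apply/seteqP; split.
have [||Z [f [W [mf Pf mW PW fW]]]] := @limit_realization R _ T P Y y psi A mpsi _ covr.
- by move=> k l kl t At m lm; apply: At; exact: leq_trans lm.
- move=> k s t As At.
  have [x [x' [Sx Gx Gx' ax ax']]] := As k (leqnn k).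
  have [z [z' [Sz Gz Gz' az az']]] := At k (leqnn k).
  rewrite /psi -ax -ax' -az -az'.
  have := qdist_lipschitz x (y k (a k x)) z (y k (a k z)).
  have := qdist_lipschitz x' (y k.+1 (a k.+1 x')) z' (y k.+1 (a k.+1 z')).
  have := GyP k x Gx; have := GyP k z Gz.
  have := GyP k.+1 x' Gx'; have := GyP k.+1 z' Gz'.
  have := dS k _ _ Sx Sz; rewrite /= [e k]half_powS !ler_norml; lra.
exists Z => k X /box_lt_coupling[pi' [S' [[c1 c2] cS' PS' dS']]].
(* X is coupled with Y k by pi', and Y k with the unit interval by its labels. *)
pose a' : borel (X * Y k)%type -> nat := a k \o snd.
have ma' : measurable_fun setT a'.
  exact: (measurableT_comp (ma k) (@measurable_snd_borel _ _ _)).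
have [||i iln|Q [Q1 Q2 Q0]] := @near_label_gluing _ _ _ _ pi' P a' (psi k) (n k) 0 ma' (mpsi k).
- by move=> t; exact: an.
- by move=> t; exact: phin.
- rewrite [P _](Pr _ (measurable_label i (mphi k))).
  have [[_ _ ->//] _] := phiP k.
  rewrite -c2; last exact: measurable_label.
  by rewrite subrr normr0.
pose F1 : set (borel (X * Y k)%type * T) := fst @^-1` (S' `&` snd @^-1` G k).
pose F2 : set (borel (X * Y k)%type * T) := snd @^-1` (A k `&` W).
pose F3 : set (borel (X * Y k)%type * T) := [set q | a' q.1 = psi k q.2].
have mS' : measurable (S' : set (borel (X * Y k)%type)).
  exact: closed_measurable.
have mG' : measurable (snd @^-1` G k : set (borel (X * Y k)%type)).
  by rewrite -[X in measurable X]setTI; apply: measurable_snd_borel.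
have mF1 : measurable F1.
  by rewrite -[F1]setTI; apply: measurable_fst => //; exact: measurableI.
have mF2 : measurable F2.
  by rewrite -[F2]setTI; apply: measurable_snd => //; exact: measurableI.
have mF3 : measurable F3.
  apply: (measurable_label2 (fun i j => i = j) (a := a' \o fst) (b := psi k \o snd)).
    exact: measurableT_comp.
  exact: measurableT_comp.
apply: (@box_le R X Z _ _ Q (fst \o fst) (f \o snd) (F1 `&` F2 `&` F3)).
- exact: (measurableT_comp (@measurable_fst_borel _ _ _) measurable_fst).
- exact: (measurableT_comp mf measurable_snd).
- move=> B mB; rewrite -c1// -Q1//.
  by rewrite -[X in measurable X]setTI; apply: measurable_fst_borel.
- move=> B mB; rewrite -Pf// -Q2//.
  by rewrite -[X in measurable X]setTI; apply: mf.
- by apply: measurableI => //; exact: measurableI.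
- rewrite (setCI (F1 `&` F2) F3) (setCI F1 F2); apply: (@le_trans _ _ ((e k + e k) + (6 * e k) + 0)%:E); last first.
    by rewrite lee_fin; have := e0 k; lra.
  apply: measureU3_le; [exact: measurableC..| | |].
  + rewrite [X in (X <= _)%E](Q1 (~` (S' `&` snd @^-1` G k))); last first.
      by apply: measurableC; exact: measurableI.
    rewrite setCI EFinD; apply: le_trans (measureU2 _ _ _) _.
    * exact: measurableC.
    * exact: measurableC.
    apply: leeD; first exact/ltW.
    rewrite [X in (X <= _)%E](c2 (~` G k)); first exact/ltW/PG.
    exact: measurableC.
  + rewrite [X in (X <= _)%E](Q2 (~` (A k `&` W))); last first.
      by apply: measurableC; exact: measurableI.
    rewrite setCI -[leRHS]adde0; apply: le_trans (measureU2 _ _ _) _.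
    * exact: measurableC.
    * exact: measurableC.
    rewrite [X in (_ + X)%E]PW leeD2r//.
    by apply: le_trans (PAr k) _; rewrite lee_fin; lra.
  + by rewrite -(mulr0 (n k).+1%:R).
- by rewrite mulr_ge0//; exact: ltW.
- move=> [[x v] t] [[x' v'] t'] [[[/= Sx Gx] [At Wt]] at_].
  move=> [[[/= Sx' Gx'] [At' Wt']] at_'].
  have := fW k t t' At At' Wt Wt'; rewrite -/(psi k t) -/(psi k t').
  rewrite -[psi k t]at_ -[psi k t']at_' /a'/=.
  have := qdist_lipschitz v (y k (a k v)) v' (y k (a k v')).
  have := GyP k v Gx; have := GyP k v' Gx'.
  have := dS' _ _ Sx Sx'; rewrite /= !ler_norml; lra.
Qed.

Lemma box_complete : complete_dist (@box_dist R).
Proof.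
move=> u cu; have e0 k : 0 < e k by exact: half_pow_gt0.
have /choice[N0 N0P] k := cu (e k) (e0 k).
(* A nondecreasing sequence of indices that dominates N0. *)
pose N k := (\sum_(i < k.+1) N0 i)%N.
have N0N k : (N0 k <= N k)%N by rewrite /N big_ord_recr/= leq_addl.
have NS k : (N k <= N k.+1)%N by rewrite /N [leqRHS]big_ord_recr/= leq_addr.
have NP k m l : (N k <= m)%N -> (N k <= l)%N ->
    (box (repr (u m)) (repr (u l)) < (e k)%:E)%E.
  by move=> km kl; apply: N0P; exact: leq_trans (N0N k) _.
have [k|Z ZP] := @chain_limit (fun k => repr (u (N k))); first exact: NP.
exists (\pi_(Xplus R) Z)%qT => r r0.
have r12 : 0 < r / 12 by rewrite divr_gt0.
have [k /(_ k (leqnn k)) hk] := half_pow_lt r12.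
exists (N k) => m km.
rewrite -[u m]reprK box_distE; apply: le_lt_trans (ZP k _ _) _.
  exact: NP.
by rewrite lte_fin; have := e0 k; lra.
Qed.

End completeness.

(** * Separability *)

Section separability.
Variable R : realType.

(** One point is chosen for each value of the code at each scale 1 / (k + 1). *)
Lemma separable_of_codes (T : choiceType) (C : countType) (dist : T -> T -> \bar R) :
  (forall e : R, 0 < e -> exists code : T -> C,
    forall x y, code x = code y -> (dist x y < e%:E)%E) ->
  separable_dist dist.
Proof.
move=> h; have /choice[code codeP] (k : nat) : exists code : T -> C,
    forall x y, code x = code y -> (dist x y < (k.+1%:R^-1)%:E)%E.
  by apply: h; rewrite invr_gt0.
have /choice[s sP] (kc : nat * C) : exists o : option T,
    forall x, code kc.1 x = kc.2 -> exists2 y, o = Some y & code kc.1 y = kc.2.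
  have [[x xc]|nx] := pselect (exists x, code kc.1 x = kc.2).
    by exists (Some x) => _ _; exists x.
  by exists None => x xc; exfalso; apply: nx; exists x.
exists (\bigcup_kc [set y | s kc = Some y]).
  apply: bigcup_countable => // kc _; case: (s kc) => [y|].
    rewrite (_ : [set _ | _] = [set y]); first exact: countable1.
    by apply/seteqP; split=> z /= => [[->]|->].
  rewrite (_ : [set _ | _] = set0); first exact: countable0.
  by apply/seteqP; split=> z.
move=> x e e0; have [k ke] := natSinv_lt e0.
have [y sy cy] := sP (k, code k x) x erefl; exists y; first by exists (k, code k x).
by apply: lt_trans (codeP k x y (esym cy)) _; rewrite lte_fin.
Qed.

Lemma truncn_near (x y K : R) : 0 < K -> 0 <= x -> 0 <= y ->
  Num.truncn (x * K) = Num.truncn (y * K) -> `|x - y| <= K^-1.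
Proof.
move=> K0 x0 y0 xy.
have /andP[x1 x2] := truncn_itv (mulr_ge0 x0 (ltW K0)).
have /andP[y1 y2] := truncn_itv (mulr_ge0 y0 (ltW K0)).
rewrite -xy in y1 y2; rewrite -(ler_pM2r K0) mulVf ?gt_eqF//.
rewrite -[X in _ * X](gtr0_norm K0) -normrM mulrBl ler_norml.
by move: x1 x2 y1 y2; rewrite -natr1; lra.
Qed.

Let code := (nat * seq nat * seq (seq nat))%type.

(** The grid has mesh 1 / K with K depending on the number of labels, so that the
errors on the masses of the labels add up to less than e. The constant 5 is
2 + 2 + 1, for the passages to the labelled points in both spaces and for the
rounding of the distances. *)
Lemma box_code (e : R) : 0 < e -> exists c : qmSpace R -> code,
  forall X Y, c X = c Y -> (box X Y <= (5 * e)%:E)%E.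
Proof.
move=> e0.
have /family_choice[n /family_choice[y /family_choice[a /family_choice[G GP]]]] :=
  fun X : qmSpace R => labelling X e0.
have /choice[K KP] (k : nat) : exists K : nat, k.+1%:R / K.+1%:R < e.
  have [K hK] : exists K : nat, K.+1%:R^-1 < e / k.+1%:R.
    by apply: natSinv_lt; rewrite divr_gt0.
  by exists K; move: hK; rewrite ltr_pdivlMr// mulrC.
pose m X i := fine (qm_measure X (a X @^-1` [set i])).
pose k X : R := (K (n X)).+1%:R.
exists (fun X => (n X,
  mkseq (fun i => Num.truncn (m X i * k X)) (n X).+1,
  mkseq (fun i => mkseq (fun j =>
    Num.truncn (qdist (y X i) (y X j) * k X)) (n X).+1) (n X).+1)).
move=> X Y cXY; have nE : n X = n Y := congr1 (fun c => c.1.1) cXY.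
have mE := congr1 (fun c => c.1.2) cXY; have dE := congr1 snd cXY.
have kE : k X = k Y by rewrite /k nE.
have kX0 : 0 < k X by rewrite /k.
have [ma an mG PG Gy] := GP X; have [ma' an' mG' PG' Gy'] := GP Y.
have near i : (i <= n X)%N -> `|m X i - m Y i| <= (k X)^-1.
  move=> ilt; apply: truncn_near => //; try exact: fine_ge0.
  have /= := congr1 (nth 0%N ^~ i) mE.
  by rewrite !nth_mkseq ?ltnS -?nE// kE.
have neard i j : (i <= n X)%N -> (j <= n X)%N ->
    `|qdist (y X i) (y X j) - qdist (y Y i) (y Y j)| <= (k X)^-1.
  move=> ilt jlt; apply: truncn_near => //; try exact: qdist_ge0.
  have /= := congr1 (fun s => nth 0%N (nth [::] s i) j) dE.
  by rewrite !nth_mkseq ?ltnS -?nE// kE.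
have kn : (n X).+1%:R * (k X)^-1 < e by exact: KP.
have ke : (k X)^-1 <= e.
  apply: le_trans (ltW kn); rewrite ler_peMl ?invr_ge0 ?ler1n//; exact: ltW.
have [|Q [Q1 Q2 Q0]] := @near_label_gluing R _ _ _ _ (qm_measure X)
    (qm_measure Y) (a X) (a Y) (n X) (k X)^-1 ma ma' an _ near.
  by move=> t; rewrite nE; exact: an'.
pose F1 : set (borel X * borel Y) := fst @^-1` G X.
pose F2 : set (borel X * borel Y) := snd @^-1` G Y.
pose F3 : set (borel X * borel Y) := [set q | a X q.1 = a Y q.2].
have mF1 : measurable F1 by rewrite -[F1]setTI; apply: measurable_fst.
have mF2 : measurable F2 by rewrite -[F2]setTI; apply: measurable_snd.
have mF3 : measurable F3.
  have m1 : measurable_fun setT (a X \o fst : borel X * borel Y -> nat).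
    exact: (measurableT_comp ma measurable_fst).
  have m2 : measurable_fun setT (a Y \o snd : borel X * borel Y -> nat).
    exact: (measurableT_comp ma' measurable_snd).
  exact: (measurable_label2 (fun i j => i = j) m1 m2).
apply: (@box_le R X Y _ _ Q fst snd (F1 `&` F2 `&` F3)).
- exact: measurable_fst.
- exact: measurable_snd.
- exact: Q1.
- exact: Q2.
- by apply: measurableI => //; exact: measurableI.
- rewrite (setCI (F1 `&` F2) F3) (setCI F1 F2).
  apply: (@le_trans _ _ (e + e + e)%:E); last by rewrite lee_fin; lra.
  apply: measureU3_le; [exact: measurableC..| | |].
  + rewrite [X in (X <= _)%E](Q1 (~` G X)); first exact/ltW.
    exact: measurableC.
  + rewrite [X in (X <= _)%E](Q2 (~` G Y)); first exact/ltW.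
    exact: measurableC.
  + by apply: le_trans Q0 _; rewrite lee_fin ltW.
- by lra.
- move=> [u v] [u' v'] [[Gu Gv] /= uv] [[Gu' Gv'] /= uv'].
  have := le_trans (neard _ _ (an u) (an u')) ke.
  have := qdist_lipschitz u (y X (a X u)) u' (y X (a X u')).
  have := qdist_lipschitz v (y Y (a Y v)) v' (y Y (a Y v')).
  rewrite -uv -uv'.
  have := Gy u Gu; have := Gy u' Gu'; have := Gy' v Gv; have := Gy' v' Gv'.
  by rewrite -uv -uv' !ler_norml /=; lra.
Qed.

Lemma box_separable : separable_dist (@box_dist R).
Proof.
apply: (@separable_of_codes (Xplus R) code) => e e0.
have [|c cP] := @box_code (e / 6); first by lra.
exists (fun x => c (repr x)) => x y /cP; move=> h; apply: le_lt_trans h _.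
by rewrite lte_fin; lra.
Qed.

End separability.

Theorem corollary3p4 (R : realType) :
  complete_dist (@box_dist R) /\ separable_dist (@box_dist R).
Proof. by split; [exact: box_complete|exact: box_separable]. Qed.
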